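(* Let $\Phi=\{S_i\}_{i=1}^m$ be an equicontractive IFS on $\mathbb{R}^d$ satisfying the finite type condition, and let $\mu$ be the self-similar measure generated by $\Phi$ and a probability vector $(p_1,\ldots,p_m)$. Then the $L^q$-spectrum $\tau(q)=\tau(\mu,q)$ of $\mu$ is differentiable as a function of $q$ on $(0,\infty)$.
   Context: A similitude on $\mathbb{R}^d$ is a map $S$ with $|S(x)-S(y)|=\rho_S|x-y|$ for some $\rho_S>0$. An IFS $\Phi=\{S_i\}_{i=1}^m$ on $\mathbb{R}^d$ is a finite family of contracting similitudes ($\rho_{S_i}<1$), assumed pairwise distinct; it is equicontractive if all $\rho_{S_i}$ are equal. $K$, the self-similar set generated by $\Phi$, is the unique non-empty compact set with $K=\bigcup_{i=1}^mS_i(K)$. A probability vector has all $p_i>0$ and $\sum p_i=1$; the self-similar measure $\mu$ is the unique Borel probability measure with $\mu=\sum_{i=1}^mp_i\,\mu\circ S_i^{-1}$. $\Sigma_n$ is the set of words of length $n$ over $\{1,\ldots,m\}$ and $S_{i_1\ldots i_n}=S_{i_1}\circ\cdots\circ S_{i_n}$. Finite type condition (FTC): there is a finite set $\Gamma$ such that for any $n\ge1$ and $I,J\in\Sigma_n$, either $S_I(K)\cap S_J(K)=\emptyset$ or $S_I^{-1}\circ S_J\in\Gamma$. For a compactly supported finite Borel measure $\nu$ on $\mathbb{R}^d$ and $q\in\mathbb{R}$, the $L^q$-spectrum is $$\tau(\nu,q)=\liminf_{\delta\to0}\frac{\log\left(\sup\sum_i\nu(B(x_i,\delta))^q\right)}{\log\delta},$$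 where the supremum is over all families of disjoint closed balls $B(x_i,\delta)$ of radius $\delta$ with centres $x_i\in\operatorname{supp}\nu$. *)

(* Defs.v *)
From HB Require Import structures.
From mathcomp Require Import all_boot all_order all_algebra.
From mathcomp Require Import all_classical all_reals all_analysis.

Set Implicit Arguments.
Unset Strict Implicit.
Unset Printing Implicit Defensive.

Import Order.TTheory GRing.Theory Num.Theory.
Import numFieldNormedType.Exports.

Local Open Scope classical_set_scope.
Local Open Scope ring_scope.

(* R^d is ['rV[R]_d]. The library's norm on row vectors is the sup norm; it
   provides the (same) topology, hence [open], [compact] and the Borel sets,
   but similitudes and balls are taken for the Euclidean norm [enorm]. *)
Definition enorm (R : realType) (d : nat) (x : 'rV[R]_d) : R :=
  Num.sqrt (\sum_(i < d) x ord0 i ^+ 2).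

Definition cball (R : realType) (d : nat) (x : 'rV[R]_d) (r : R) :
    set 'rV[R]_d :=
  [set y | enorm (y - x) <= r].

Definition borel_rV (R : realType) (d : nat) :=
  g_sigma_algebraType (@open 'rV[R]_d).

Definition similitude (R : realType) (d : nat) (rho : R)
    (f : 'rV[R]_d -> 'rV[R]_d) : Prop :=
  0 < rho /\ forall x y, enorm (f x - f y) = rho * enorm (x - y).

Definition is_ifs (R : realType) (d m : nat)
    (S : 'I_m -> 'rV[R]_d -> 'rV[R]_d) : Prop :=
  injective S /\ forall i, exists2 rho : R, rho < 1 & similitude rho (S i).

Definition equicontractive (R : realType) (d m : nat)
    (S : 'I_m -> 'rV[R]_d -> 'rV[R]_d) : Prop :=
  exists rho : R, forall i, similitude rho (S i).

Definition self_similar_set (R : realType) (d m : nat)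
    (S : 'I_m -> 'rV[R]_d -> 'rV[R]_d) (K : set 'rV[R]_d) : Prop :=
  [/\ K !=set0, compact K & K = \bigcup_(i in [set: 'I_m]) (S i @` K)].

Definition probability_vector (R : realType) (m : nat) (p : 'I_m -> R) : Prop :=
  (forall i, 0 < p i) /\ \sum_(i < m) p i = 1.

Definition self_similar_measure (R : realType) (d m : nat)
    (S : 'I_m -> 'rV[R]_d -> 'rV[R]_d) (p : 'I_m -> R)
    (mu : probability (borel_rV R d) R) : Prop :=
  forall A : set (borel_rV R d), measurable A ->
    mu A = (\sum_(i < m) (p i)%:E * mu (S i @^-1` A))%E.

Definition word_map (R : realType) (d m : nat)
    (S : 'I_m -> 'rV[R]_d -> 'rV[R]_d) (I : seq 'I_m) : 'rV[R]_d -> 'rV[R]_d :=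
  foldr (fun i f => S i \o f) id I.

(* Similitudes of R^d are bijective, so [pinv setT] is their actual inverse. *)
Definition finite_type_condition (R : realType) (d m : nat)
    (S : 'I_m -> 'rV[R]_d -> 'rV[R]_d) (K : set 'rV[R]_d) : Prop :=
  exists Gamma : set ('rV[R]_d -> 'rV[R]_d), finite_set Gamma /\
    forall (n : nat) (I J : n.-tuple 'I_m), (0 < n)%N ->
      word_map S I @` K `&` word_map S J @` K = set0 \/
      Gamma (pinv setT (word_map S I) \o word_map S J).

Definition supp (R : realType) (d : nat)
    (nu : {finite_measure set (borel_rV R d) -> \bar R}) : set 'rV[R]_d :=
  [set x | forall U : set 'rV[R]_d, open U -> U x -> (0 < nu U)%E].

(* Disjoint balls of positive radius have distinct centres, so a family of
   disjoint closed balls of radius delta is given by its set of centres. *)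
Definition packing_sup (R : realType) (d : nat)
    (nu : {finite_measure set (borel_rV R d) -> \bar R}) (q delta : R) :
    \bar R :=
  ereal_sup [set (\esum_(x in C) (nu (cball x delta) `^ q))%E
            | C in [set C : set 'rV[R]_d | C `<=` supp nu /\
                                           trivIset C (fun x => cball x delta)]].

Definition Lq_spectrum (R : realType) (d : nat)
    (nu : {finite_measure set (borel_rV R d) -> \bar R}) (q : R) : \bar R :=
  limf_einf
    (fun delta : R => lne (packing_sup nu q delta) * ((ln delta)^-1)%:E)%E
    0^'+.

(* Main.v *)
Require Import Defs.
From HB Require Import structures.
From mathcomp Require Import all_boot all_order all_algebra.
From mathcomp Require Import ring lra zify.
From mathcomp Require Import all_classical all_reals all_analysis.
Import Order.TTheory GRing.Theory Num.Theory.
Import numFieldNormedType.Exports.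
Local Open Scope classical_set_scope.
Local Open Scope ring_scope.

(* Let G_n be the finite set of distinct maps S_I with |I| = n, let P(f) be the
   total weight of the words I with S_I = f, and Z_n(q) = sum of P(f)^q over G_n.
   The finite type condition bounds the number of f in G_n that send K near a
   given point at scale rho^n, so packing sums at scale rho^n are comparable to
   Z_n(q), and an h in G_(n+k) has boundedly many factorisations h = f g with f
   in G_n and g in G_k. As P(fg) >= P(f) P(g), with equality up to a constant for
   the best factorisation, Z_n(q) Z_k(q) is comparable to Z_(n+k)(q); hence
   log Z_n(q) = n Pr(q) + O(1) and tau(q) = Pr(q) / log rho.

   Differentiability. Choose e so that f e u has, beyond f, as many prefixes as
   possible: then P(f e e u) is comparable to P(f e) P(e u) for all f and u.
   Suppose that the convex function Pr has slopes al < be on the two sides of q.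
   Give h in G_N the probability P(h)^q / Z_N(q). With a probability bounded below
   independently of N, log P(h) is close to N be, and likewise for N al. Cut h in
   G_((k+1)n) into blocks of length n; the event that the first blocks follow be
   and the next one follows al has probability bounded below, whatever the position
   of that block, whereas two such events for different positions are almost
   disjoint. This is impossible once k is large. *)

Set Implicit Arguments.
Unset Strict Implicit.
Unset Printing Implicit Defensive.

(** * Sums, sequences and levels *)

(** The obstacle is that P(fg) can be much larger than P(f) P(g): only the best factorisation of h
    is controlled, and it need not be the given one. The word e removes this: by maximality of its
    number of prefixes, every cut of f e u inside e comes from a cut of e, whose factors range over
    finite sets and cost O(1).

    The contradiction is a count. Each of the k events has a definite share of the mass. If two of
    them hold, the piece between their positions must beat the slope be by about n (be - al);
    passing from exponent q to q + t bounds the mass of this by exp(- t n (be - al)) up to errors.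
    With t = s / n this is the constant exp(- s (be - al)), small for large s, and
    inclusion-exclusion then bounds k by a constant.

    The parameters are thus chosen in the order k, s, width of the bands, n. The share of each event
    must not depend on the width; hence the bands are estimated from moments at exponents within
    O(1/n) of q. *)

Section Levels.
Local Open Scope nat_scope.

(** Arithmetic of the levels at which an element with two low blocks is cut: [n] is the block length
    and [l], or [a + b], the level of the synchronising word. Subtraction truncates, hence the lower
    bounds on [n]. *)
Lemma level_head i n l : l + l <= n ->
  i.+2 * n - l = i.+1 * n + (l + (n - (l + l))).
Proof. by move=> ln; rewrite !mulSn; lia. Qed.

Lemma level_split i j n a b : i < j -> a + b + (a + b) <= n ->
  j.+1 * n = i.+2 * n - (a + b) + a + ((j - i.+1) * n + b).
Proof.
move=> ij ln; move: (j - i.+1) (subnKC ij) => t <-.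
by rewrite !mulSn mulnDl; lia.
Qed.

Lemma level_tail n j k : j < k -> (k - j) * n = n + (k - j.+1) * n.
Proof. by move=> jk; rewrite -mulSn subnSK. Qed.

Lemma level_rest n b i j k : i < j -> j < k ->
  (j - i.+1) * n + b + (n + (k - j.+1) * n) = b + (k - i.+1) * n.
Proof.
move=> ij jk; have -> : k - i.+1 = (j - i.+1) + (k - j) by lia.
by rewrite mulnDl (level_tail n jk); lia.
Qed.

Lemma level_count i j k : i < j -> j < k -> j + i + 3 <= 2 * k.
Proof. lia. Qed.

Lemma level_total i j k n a b : i < j -> j < k -> a + b + (a + b) <= n ->
  i.+2 * n - (a + b) + a + ((j - i.+1) * n + b) + (k - j) * n = k.+1 * n.
Proof.
move=> ij jk ln; rewrite -level_split// -mulnDl addSn subnKC//; exact: ltnW.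
Qed.

End Levels.

Section FiniteSums.
Variable (R : realType).

(** Different [x] use different [y], as [phi] recovers [x]; summing over the fibres of [phi] avoids
    choosing them. It bounds a mass from above by one good factorisation of each element. *)
Lemma ler_sum_cover (X Y : eqType) (s : seq X) (T : seq Y) (phi : Y -> X)
    (a : X -> R) (b : Y -> R) :
  uniq s -> {in T, forall y, 0 <= b y} ->
  {in s, forall x, exists y, [/\ y \in T, phi y = x & a x <= b y]} ->
  \sum_(x <- s) a x <= \sum_(y <- T) b y.
Proof.
move=> us b0 ab.
have H : {in s, forall x, a x <= \sum_(y <- T | phi y == x) b y}.
  move=> x xs; have [y [yT yx axy]] := ab _ xs.
  apply: (le_trans axy).
  rewrite big_mkcond (perm_big _ (perm_to_rem yT)) big_cons /= yx eqxx lerDl.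
  rewrite big_seq sumr_ge0// => z /mem_rem zT.
  by case: ifP => // _; apply: b0.
rewrite big_seq; apply: (le_trans (ler_sum _ H)); rewrite -big_seq.
rewrite (exchange_big_dep predT)//= big_seq [leRHS]big_seq.
apply: ler_sum => y yT; rewrite big_const_seq iter_addr_0.
have : (count (fun x => phi y == x) s <= 1)%N.
  by rewrite (@eq_count _ _ (pred1 (phi y))) ?count_uniq_mem ?leq_b1// => x;
    rewrite /= eq_sym.
by case: count => [|[|//]] _; rewrite ?mulr0n ?mulr1n ?b0.
Qed.

(** Grouped by the fibres of [phi], the left-hand sum uses each [a x] at most [N] times. It bounds a
    product of masses by the mass of the products. *)
Lemma ler_sum_mult (X Y : eqType) (s : seq X) (T : seq Y) (phi : Y -> X)
    (a : X -> R) (b : Y -> R) (N : nat) :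
  uniq s -> {in s, forall x, 0 <= a x} ->
  {in T, forall y, phi y \in s /\ b y <= a (phi y)} ->
  {in s, forall x, (count (fun y => phi y == x) T <= N)%N} ->
  \sum_(y <- T) b y <= N%:R * \sum_(x <- s) a x.
Proof.
move=> us a0 ba cN.
have H : {in T, forall y, b y <= \sum_(x <- s | phi y == x) a x}.
  move=> y yT; have [ys byx] := ba _ yT.
  apply: (le_trans byx).
  rewrite big_mkcond (perm_big _ (perm_to_rem ys)) big_cons /= eqxx lerDl.
  rewrite big_seq sumr_ge0// => z /mem_rem zT.
  by case: ifP => // _; apply: a0.
rewrite big_seq; apply: (le_trans (ler_sum _ H)); rewrite -big_seq.
rewrite (exchange_big_dep predT)//= big_seq mulr_sumr [leRHS]big_seq.
apply: ler_sum => x xs; rewrite big_const_seq iter_addr_0 -[leLHS]mulr_natl.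
by rewrite ler_wpM2r ?a0 ?ler_nat ?cN.
Qed.

Lemma sum_allpairs (T T' : Type) (s : seq T) (t : seq T') (F : T * T' -> R) :
  \sum_(y <- [seq (f, g) | f <- s, g <- t]) F y =
  \sum_(f <- s) \sum_(g <- t) F (f, g).
Proof. exact: big_allpairs. Qed.

Lemma count_allpairs_le (T T' : Type) (s : seq T) (t : seq T')
    (P : T -> T' -> bool) (P' : T -> bool) :
  (forall f, (count (P f) t <= P' f)%N) ->
  (count (fun y => P y.1 y.2) [seq (f, g) | f <- s, g <- t] <= count P' s)%N.
Proof.
move=> H; elim: s => //= f s IH.
rewrite count_cat leq_add// (leq_trans _ (H f))//.
by rewrite count_map; apply: eq_leq; apply: eq_count.
Qed.

(** A Bonferroni inequality: if [i] is the least index with [b i], the pairs starting at [i] already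
    count all the other true indices. *)
Lemma sum_bool_pairs k (b : 'I_k -> bool) :
  \sum_(i < k) (b i)%:R <=
  1 + \sum_(i < k) \sum_(j < k | (i < j)%N) (b i && b j)%:R :> R.
Proof.
case: (pickP b) => [i0 bi0|b0]; last first.
  rewrite big1 ?addr_ge0//; last by move=> i _; rewrite b0.
  by rewrite sumr_ge0// => i _; rewrite sumr_ge0.
case: (arg_minnP (fun i : 'I_k => i : nat) bi0) => i bi mini.
rewrite (bigD1 i)//= bi lerD2l [leRHS](bigD1 i)//= ler_wpDr ?sumr_ge0//.
  by move=> j _; rewrite sumr_ge0.
rewrite big_mkcond [leRHS]big_mkcond /=; apply: ler_sum => j _.
case: eqVneq => [->|ji]; first by rewrite ltnn.
rewrite /=; case: (boolP (b j)) => bj; last by rewrite andbF if_same.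
have := mini _ bj; rewrite leq_eqVlt eq_sym (negbTE (_ : _ != _ :> nat)).
  by move=> /= ->; rewrite bi.
by move: ji; apply: contraNN => /eqP/val_inj ->.
Qed.

End FiniteSums.

Section RealSequences.
Variable (R : realType).

Lemma le0_of_natr_mul_bounded (x K : R) : (forall n : nat, n%:R * x <= K) -> x <= 0.
Proof.
move=> H; rewrite leNgt; apply/negP => x0.
have := H (Num.truncn (`|K| / x)).+1; rewrite leNgt => /negP; apply.
have : `|K| / x < (Num.truncn (`|K| / x)).+1%:R by rewrite truncnS_gt.
rewrite ltr_pdivrMr// => /(le_lt_trans _); apply; exact: ler_norm.
Qed.

(** Evaluating [a] at a product of two positive indices in both ways puts every [(a n - K) / n]
    below every [(a k + K) / k]; a number between the two families is the slope [p]. *)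
Lemma quasi_additive_limit (a : nat -> R) (K : R) :
  (forall n k, `|a (n + k)%N - a n - a k| <= K) ->
  exists p, forall n, `|a n - n%:R * p| <= K.
Proof.
move=> aK.
have K0 : 0 <= K by apply: (le_trans (normr_ge0 _) (aK 0 0)%N).
have mulK n k : `|a (n * k.+1)%N - k.+1%:R * a n| <= k%:R * K.
  elim: k => [|k IH]; first by rewrite muln1 mul1r subrr normr0 mul0r.
  rewrite mulnS addnC.
  have := aK (n * k.+1)%N n.
  move: IH; rewrite -[k.+2%:R]natr1 -[k.+1%:R]natr1 !ler_norml.
  by move=> /andP[? ?] /andP[? ?]; apply/andP; split; lra.
have le2 n k : (a n.+1 - K) / n.+1%:R <= (a k.+1 + K) / k.+1%:R.
  rewrite ler_pdivrMr ?ltr0n// mulrAC ler_pdivlMr ?ltr0n//.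
  have := mulK n.+1 k; have := mulK k.+1 n; rewrite mulnC.
  rewrite -[n.+1%:R]natr1 -[k.+1%:R]natr1 !ler_norml; nra.
pose E := [set (a n.+1 - K) / n.+1%:R | n in [set: nat]].
exists (sup E) => -[|n].
  by rewrite mul0r subr0; have := aK 0%N 0%N; rewrite addn0 subrr sub0r normrN.
have hE : has_sup E.
  split; first by exists ((a 1%N - K) / 1%:R), 0%N.
  by exists ((a 1%N + K) / 1%:R) => _ [k _ <-]; apply: le2.
have n0 : 0 < n.+1%:R :> R by rewrite ltr0n.
have h1 : (a n.+1 - K) / n.+1%:R <= sup E.
  by apply: sup_upper_bound => //; exists n.
have h2 : sup E <= (a n.+1 + K) / n.+1%:R.
  by apply: sup_le_ub; [exact: hE.1|move=> _ [k _ <-]; apply: le2].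
move: h1 h2; rewrite ler_pdivrMr// ler_pdivlMr// ler_norml.
by rewrite mulrC; lra.
Qed.

End RealSequences.

(** * Convex functions and exponential moments *)

Section OneSidedSlopes.
Variable (R : realType).

(** [al] and [be] are the left and right derivatives, obtained as a supremum and an infimum of chord
    slopes. Convexity is given on the positive half-line only, hence the steps [t < q]. *)
Lemma convex_slopes (f : R -> R) (q : R) :
  0 < q ->
  (forall a b x, 0 < a -> 0 < b -> 0 <= x <= 1 ->
    f (x * a + (1 - x) * b) <= x * f a + (1 - x) * f b) ->
  exists al be : R, [/\ al <= be,
    forall t, 0 < t < q -> f q + be * t <= f (q + t),
    forall t, 0 < t < q -> f q - al * t <= f (q - t) &
    forall eps, 0 < eps -> exists2 t1, 0 < t1 < q & forall t, 0 < t <= t1 ->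
      f (q + t) <= f q + (be + eps) * t /\ f (q - t) <= f q - (al - eps) * t].
Proof.
move=> q0 cf.
have mid t u : 0 < t < q -> 0 < u < q ->
    (f q - f (q - u)) / u <= (f (q + t) - f q) / t.
  move=> /andP[t0 tq] /andP[u0 uq].
  have tu0 : 0 < t + u by rewrite addr_gt0.
  have := cf (q + t) (q - u) (u / (t + u)).
  have -> : u / (t + u) * (q + t) + (1 - u / (t + u)) * (q - u) = q.
    by field; rewrite gt_eqF.
  have x1 : 0 <= u / (t + u) <= 1.
    by apply/andP; split; [apply: divr_ge0; lra|rewrite ler_pdivrMr//; lra].
  move=> /(_ ltac:(lra) ltac:(lra) x1).
  have -> : u / (t + u) * f (q + t) + (1 - u / (t + u)) * f (q - u) =
     (u * f (q + t) + t * f (q - u)) / (t + u) by field; rewrite gt_eqF.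
  rewrite ler_pdivlMr// => H.
  by rewrite ler_pdivrMr// mulrAC ler_pdivlMr//; lra.
have monor t u : 0 < t -> t <= u -> u < q ->
    f (q + t) - f q <= t * ((f (q + u) - f q) / u).
  move=> t0 tu uq; have u0 : 0 < u by lra.
  have := cf (q + u) q (t / u).
  have -> : t / u * (q + u) + (1 - t / u) * q = q + t.
    by field; rewrite gt_eqF.
  have x1 : 0 <= t / u <= 1.
    by apply/andP; split; [apply: divr_ge0; lra|rewrite ler_pdivrMr//; lra].
  move=> /(_ ltac:(lra) ltac:(lra) x1).
  by rewrite -[(1 - _) * _]/(_) mulrBl mul1r mulrA [t * _]mulrC; lra.
have monol t u : 0 < t -> t <= u -> u < q ->
    f (q - t) - f q <= - t * ((f q - f (q - u)) / u).
  move=> t0 tu uq; have u0 : 0 < u by lra.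
  have := cf (q - u) q (t / u).
  have -> : t / u * (q - u) + (1 - t / u) * q = q - t.
    by field; rewrite gt_eqF.
  have x1 : 0 <= t / u <= 1.
    by apply/andP; split; [apply: divr_ge0; lra|rewrite ler_pdivrMr//; lra].
  move=> /(_ ltac:(lra) ltac:(lra) x1).
  rewrite mulrBl mul1r.
  have -> : - t * ((f q - f (q - u)) / u) = t / u * f (q - u) - t / u * f q.
    by field; rewrite gt_eqF.
  by lra.
pose A := [set (f q - f (q - u)) / u | u in [set u | 0 < u < q]].
pose B := [set (f (q + u) - f q) / u | u in [set u | 0 < u < q]].
have h0 : 0 < q / 2 < q by lra.
have hA : has_sup A.
  split; first by exists ((f q - f (q - q / 2)) / (q / 2)), (q / 2).
  by exists ((f (q + q / 2) - f q) / (q / 2)) => _ [u /= uq <-]; apply: mid.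
have hB : has_inf B.
  split; first by exists ((f (q + q / 2) - f q) / (q / 2)), (q / 2).
  by exists ((f q - f (q - q / 2)) / (q / 2)) => _ [u /= uq <-]; apply: mid.
exists (sup A), (inf B); split.
- apply: sup_le_ub; first exact: hA.1.
  move=> _ [u /= uq <-]; apply: lb_le_inf; first exact: hB.1.
  by move=> _ [t /= tq <-]; apply: mid.
- move=> t /[dup] tq /andP[t0 _].
  have : inf B <= (f (q + t) - f q) / t by apply: ge_inf; [exact: hB.2|exists t].
  by rewrite ler_pdivlMr//; lra.
- move=> t /[dup] tq /andP[t0 _].
  have : (f q - f (q - t)) / t <= sup A by apply: sup_upper_bound => //; exists t.
  by rewrite ler_pdivrMr//; lra.
- move=> eps eps0.
  have [_ [u /= /andP[u0 uq] <-] ub] := inf_adherent eps0 hB.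
  have [_ [v /= /andP[v0 vq] <-] vb] := sup_adherent eps0 hA.
  exists (Num.min u v).
    by rewrite lt_min u0 v0 gt_min uq.
  move=> t /andP[t0]; rewrite le_min => /andP[tu tv]; split.
    have := monor _ _ t0 tu uq; move: ub; set x := (_ / u) => xb H.
    have : t * x <= t * (inf B + eps) by rewrite ler_wpM2l// ltW.
    by lra.
  have := monol _ _ t0 tv vq; move: vb; set x := (_ / v) => xb H.
  have : t * (sup A - eps) <= t * x by rewrite ler_wpM2l// ltW.
  by lra.
Qed.

Lemma derivable_slopes (f : R -> R) (q al : R) : 0 < q ->
  (forall t, 0 < t < q -> f q + al * t <= f (q + t)) ->
  (forall t, 0 < t < q -> f q - al * t <= f (q - t)) ->
  (forall eps, 0 < eps -> exists2 t1, 0 < t1 < q & forall t, 0 < t <= t1 ->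
     f (q + t) <= f q + (al + eps) * t /\ f (q - t) <= f q - (al - eps) * t) ->
  derivable f q 1.
Proof.
move=> q0 fr fl fe; apply/cvg_ex; exists al.
apply/cvgrPdist_le => /= eps eps0.
have [t1 /andP[t10 t1q] H] := fe _ eps0.
exists t1 => //= t tt1 t0.
have {}tt1 : `|t| < t1 by move: tt1; rewrite /ball_ /= sub0r normrN.
have -> : al - t^-1 *: (f (t%:A + q) - f q) = al - (f (q + t) - f q) / t.
  by rewrite [t%:A]mulr1 (addrC t) [_ *: _]mulrC.
case: (ltgtP t 0) t0 => [tn|tp|//] _.
  have tpos : 0 < - t by lra.
  have tlt : - t < t1 by move: tt1; rewrite ltr0_norm.
  have [_] := H (- t) ltac:(lra); have := fl (- t) ltac:(lra).
  rewrite opprK => h1 h2.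
  rewrite (_ : al - _ = (al * t - (f (q + t) - f q)) / t); last first.
    by field; rewrite lt_eqF.
  rewrite normrM normfV ler_pdivrMr ?normr_gt0 ?lt_eqF//.
  by rewrite (ltr0_norm tn) ler_norml; apply/andP; split; lra.
have tlt : t < t1 by move: tt1; rewrite gtr0_norm.
have [h2 _] := H t ltac:(lra); have h1 := fr t ltac:(lra).
rewrite (_ : al - _ = (al * t - (f (q + t) - f q)) / t); last first.
  by field; rewrite gt_eqF.
rewrite normrM normfV ler_pdivrMr ?normr_gt0 ?gt_eqF//.
by rewrite (gtr0_norm tp) ler_norml; apply/andP; split; lra.
Qed.

End OneSidedSlopes.

(** * Exponential sums: convexity in the exponent and second moments *)

Section ExponentialSums.
Variable (R : realType).

(** Hölder's inequality in logarithmic form. It holds term by term once both sums are normalised to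
    1, by the tangent line of the exponential at the convex combination [m]. *)
Lemma ln_sum_expR_convex (X : Type) (s : seq X) (Y : X -> R) (a b x : R) :
  0 <= x <= 1 -> 0 < \sum_(f <- s) expR (a * Y f) ->
  0 < \sum_(f <- s) expR (b * Y f) ->
  ln (\sum_(f <- s) expR ((x * a + (1 - x) * b) * Y f)) <=
  x * ln (\sum_(f <- s) expR (a * Y f)) +
  (1 - x) * ln (\sum_(f <- s) expR (b * Y f)).
Proof.
move=> /andP[x0 x1] A0 B0.
have C0 : 0 < \sum_(f <- s) expR ((x * a + (1 - x) * b) * Y f).
  move: A0; case: s {B0} => [|y s]; first by rewrite !big_nil.
  by move=> _; rewrite big_cons ltr_pwDl ?expR_gt0 ?sumr_ge0// => ? _;
    apply: expR_ge0.
move: A0 B0; set A := \sum_(f <- s) expR (a * _);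
  set B := \sum_(f <- s) expR (b * _) => A0 B0.
rewrite -ler_expR lnK ?posrE//.
set D := x * ln A + _.
have E f : expR ((x * a + (1 - x) * b) * Y f) <=
   expR D * (x * (expR (a * Y f) / A) + (1 - x) * (expR (b * Y f) / B)).
  have -> : expR (a * Y f) / A = expR (a * Y f - ln A) by rewrite expRB lnK.
  have -> : expR (b * Y f) / B = expR (b * Y f - ln B) by rewrite expRB lnK.
  set u := a * _ - _; set v := b * _ - _.
  have -> : (x * a + (1 - x) * b) * Y f = D + (x * u + (1 - x) * v).
    by rewrite /D /u /v; ring.
  rewrite expRD ler_pM2l ?expR_gt0//.
  set m := x * u + _.
  have T z : expR m * (1 + (z - m)) <= expR z.
    have -> : expR z = expR m * expR (z - m) by rewrite -expRD addrC subrK.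
    by rewrite ler_pM2l ?expR_gt0// expR_ge1Dx.
  have -> : expR m = x * (expR m * (1 + (u - m))) + (1 - x)
    * (expR m * (1 + (v - m))).
    by rewrite /m; ring.
  by rewrite lerD// ler_wpM2l ?subr_ge0.
apply: (le_trans (ler_sum _ (fun f _ => E f))).
rewrite -mulr_sumr big_split/= -!mulr_sumr -!mulr_suml -/A -/B.
by rewrite !divff ?gt_eqF// !mulr1 addrC subrK mulr1.
Qed.

(* Only the exponential moments of orders 1 and 2 enter, so the lower bound
   on the mass of the band does not degrade as the band shrinks. *)
Lemma band_mass (X : Type) (T : seq X) (w V : X -> R) (A C eta : R) :
  1 <= C -> 0 <= A -> (forall x, 0 <= w x) ->
  A / C <= \sum_(x <- T) w x * expR (V x) ->
  \sum_(x <- T) w x * expR (2 * V x) <= 2 * C * A ->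
  \sum_(x <- T) w x <= C * A ->
  12 * C ^+ 2 <= expR eta ->
  A / (4 * C ^+ 3) <= \sum_(x <- T | `|V x| <= eta) w x.
Proof.
move=> C1 A0 w0 h1 h2 h0 he.
have C0 : 0 < C by lra.
have e0 := expR_gt0 (- eta).
have hE : expR (- eta) <= (12 * C ^+ 2)^-1.
  by rewrite expRN lef_pV2// posrE ?expR_gt0// mulr_gt0 ?exprn_gt0.
(* In the band, the arithmetic-geometric mean inequality splits [expR (V x)] into a constant and a
   small multiple of its square. Outside, it is at most [expR (- eta)] times 1 or its own square.
   The terms other than the band mass then sum to at most half of [A / C]. *)
have P x : w x * expR (V x) <= w x * expR (- eta) + w x * expR (2 * V x)
  * expR (- eta)
    + (if `|V x| <= eta then 2 * C ^+ 2 * w x else 0)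
    + w x * expR (2 * V x) / (8 * C ^+ 2).
  have -> : expR (2 * V x) = expR (V x) ^+ 2 by rewrite -expRM_natl.
  have -> : (if `|V x| <= eta then 2 * C ^+ 2 * w x else 0) =
      w x * (if `|V x| <= eta then 2 * C ^+ 2 else 0) by case: ifP => _; ring.
  suff /(ler_wpM2l (w0 x))/le_trans : expR (V x) <= expR (- eta) +
      expR (V x) ^+ 2 * expR (- eta) +
      (if `|V x| <= eta then 2 * C ^+ 2 else 0) + expR (V x) ^+ 2 / (8 * C ^+ 2).
    by apply; rewrite le_eqVlt; apply/orP; left; apply/eqP; ring.
  have V0 := expR_gt0 (V x).
  have D0 : 0 <= expR (V x) ^+ 2 / (8 * C ^+ 2).
    by rewrite divr_ge0// ?exprn_ge0 ?mulr_ge0 ?exprn_ge0 ?ltW.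
  case: ifPn => [_|].
    have -> : expR (V x) ^+ 2 / (8 * C ^+ 2) = (expR (V x) / C) ^+ 2 / 8.
      by field; rewrite gt_eqF.
    have : 0 <= (expR (V x) / C - 4 * C) ^+ 2 by exact: sqr_ge0.
    have -> : (expR (V x) / C - 4 * C) ^+ 2 =
      (expR (V x) / C) ^+ 2 - 8 * expR (V x) + 16 * C ^+ 2.
      by field; rewrite gt_eqF.
    have : 0 <= expR (V x) ^+ 2 * expR (- eta) by rewrite mulr_ge0 ?sqr_ge0 ?ltW.
    by lra.
  rewrite -ltNge => Ve.
  suff : expR (V x) <= expR (- eta) + expR (V x) ^+ 2 * expR (- eta) by lra.
  have [Vn|Vp] := leP (V x) 0.
    move: Ve; rewrite ler0_norm// => Ve.
    have : expR (V x) <= expR (- eta) by rewrite ler_expR; lra.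
    have : 0 <= expR (V x) ^+ 2 * expR (- eta) by rewrite mulr_ge0 ?sqr_ge0 ?ltW.
    by lra.
  move: Ve; rewrite gtr0_norm// => Ve.
  suff : expR (V x) <= expR (V x) ^+ 2 * expR (- eta) by lra.
  by rewrite -expRM_natl -expRD ler_expR; lra.
have := le_trans h1 (ler_sum _ (fun x _ => P x)).
rewrite !big_split/= -!mulr_suml -big_mkcond/= -mulr_sumr.
set W := \sum_(x <- T | `|V x| <= eta) w x => hW.
move: h0 h2 hW; set S0 := \sum_(x <- T) w x; set S2 := \sum_(x <- T) _ => h0 h2 hW.
have S00 : 0 <= S0 by apply: sumr_ge0.
have S20 : 0 <= S2 by apply: sumr_ge0 => x _; rewrite mulr_ge0 ?expR_ge0.
have a1 : (S0 + S2) * expR (- eta) <= (3 * C * A) * (12 * C ^+ 2)^-1.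
  by apply: ler_pM => //; [exact: addr_ge0|lra].
have a2 : S2 / (8 * C ^+ 2) <= (2 * C * A) / (8 * C ^+ 2).
  by rewrite ler_wpM2r// invr_ge0 mulr_ge0 ?exprn_ge0 ?ltW.
have a3 : (3 * C * A) * (12 * C ^+ 2)^-1 = A / C / 4 by field; rewrite gt_eqF.
have a4 : (2 * C * A) / (8 * C ^+ 2) = A / C / 4 by field; rewrite gt_eqF.
have -> : A / (4 * C ^+ 3) = (A / C / 2) / (2 * C ^+ 2) by field; rewrite gt_eqF.
rewrite ler_pdivrMr ?mulr_gt0 ?exprn_gt0//; move: a1 a2; rewrite a3 a4 => a1 a2;
  lra.
Qed.

End ExponentialSums.

(** * Pressure of a graded cancellative monoid *)

Section GradedMonoid.
Variables (R : realType) (X : eqType) (mul : X -> X -> X) (G : nat -> seq X).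
Variables (Y : X -> R) (c : R) (N : nat).

Local Notation "f ** g" := (mul f g) (at level 40, left associativity).

Hypothesis mulA : associative mul.
Hypothesis c_ge0 : 0 <= c.
Hypothesis N_gt0 : (0 < N)%N.
Hypothesis G_uniq : forall n, uniq (G n).
Hypothesis G_ex : forall n, exists f, f \in G n.
Hypothesis G_mul : forall n k f g, f \in G n -> g \in G k -> f ** g \in G (n + k)%N.
Hypothesis G_canL : forall n k f g g', f \in G n -> g \in G k -> g' \in G k ->
  f ** g = f ** g' -> g = g'.
Hypothesis G_canR : forall n k f f' g, f \in G n -> f' \in G n -> g \in G k ->
  f ** g = f' ** g -> f = f'.
Hypothesis Y_le0 : forall n f, f \in G n -> Y f <= 0.
Hypothesis Y_mul : forall n k f g, f \in G n -> g \in G k ->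
  Y f + Y g <= Y (f ** g).
Hypothesis Y_fact : forall n k h, h \in G (n + k)%N -> exists f g,
  [/\ f \in G n, g \in G k, f ** g = h & Y h <= Y f + Y g + c].

Definition prefixes n k h := [seq f <- G n | has (fun g => f ** g == h) (G k)].

Hypothesis prefixes_bound : forall n k h, h \in G (n + k)%N ->
  (size (prefixes n k h) <= N)%N.

Arguments G_mul {n k f g}.
Arguments G_canL {n k f g g'}.
Arguments G_canR {n k f f' g}.
Arguments Y_le0 {n f}.
Arguments Y_mul {n k f g}.
Arguments Y_fact {n k h}.
Arguments prefixes_bound {n k h}.

(** With [Y] the logarithm of P, [mass (G n) q] is Z_n(q); sub-families of a level are weighed in
    the same way. *)
Definition mass (s : seq X) (q : R) : R := \sum_(f <- s) expR (q * Y f).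

Lemma mass_ge0 s (q : R) : 0 <= mass s q.
Proof. by rewrite sumr_ge0// => ? _; apply: expR_ge0. Qed.

Lemma mass_gt0 n (q : R) : 0 < mass (G n) q.
Proof.
have [f fG] := G_ex n.
rewrite /mass (perm_big _ (perm_to_rem fG)) big_cons ltr_pwDl ?expR_gt0//.
exact: mass_ge0.
Qed.

Lemma mass_sub s s' (q : R) : uniq s -> {subset s <= s'} -> mass s q <= mass s' q.
Proof.
move=> us ss; apply: (@ler_sum_cover _ _ _ _ _ id) => // x xs.
by exists x; split => //; apply: ss.
Qed.

Lemma mass_cover3 (S A B D : seq X) (C q : R) : 0 <= q -> uniq S ->
  {in S, forall h, exists f g k, [/\ f \in A, g \in B, k \in D, f ** g ** k = h &
    Y h <= Y f + Y g + Y k + C]} ->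
  mass S q <= expR (q * C) * (mass A q * mass B q * mass D q).
Proof.
move=> q0 uS H.
have -> : expR (q * C) * (mass A q * mass B q * mass D q) =
    \sum_(y <- [seq (f, gk) | f <- A, gk <- [seq (g, k) | g <- B, k <- D]])
      expR (q * (Y y.1 + Y y.2.1 + Y y.2.2 + C)).
  rewrite sum_allpairs /= /mass -mulrA mulrCA mulr_suml; apply: eq_bigr => f _.
  rewrite sum_allpairs /= mulrA mulr_suml mulr_sumr; apply: eq_bigr => g _.
  rewrite !mulr_sumr; apply: eq_bigr => k _.
  by rewrite -!expRD; congr expR; ring.
apply: (@ler_sum_cover _ _ _ _ _ (fun y => y.1 ** y.2.1 ** y.2.2)) =>
  // h /H[f [g [k [fA gB kD e Yh]]]]; exists (f, (g, k)); split => //.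
  by apply/allpairsP; exists (f, (g, k)); split => //; apply/allpairsP;
    exists (g, k).
by rewrite ler_expR ler_wpM2l.
Qed.

Lemma mass_cover (S A B : seq X) (C q : R) : 0 <= q -> uniq S ->
  {in S, forall h, exists f g, [/\ f \in A, g \in B, f ** g = h &
    Y h <= Y f + Y g + C]} ->
  mass S q <= expR (q * C) * (mass A q * mass B q).
Proof.
move=> q0 uS H.
have -> : expR (q * C) * (mass A q * mass B q) =
    \sum_(y <- [seq (f, g) | f <- A, g <- B]) expR (q * (Y y.1 + Y y.2 + C)).
  rewrite sum_allpairs /= /mass mulrCA mulr_suml; apply: eq_bigr => f _.
  rewrite !mulr_sumr; apply: eq_bigr => g _.
  by rewrite -!expRD; congr expR; ring.
apply: (@ler_sum_cover _ _ _ _ _ (fun y => y.1 ** y.2)) =>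
  // h /H[f [g [fA gB e Yh]]]; exists (f, g); split => //.
  by apply/allpairsP; exists (f, g).
by rewrite ler_expR ler_wpM2l.
Qed.

(** [Y] is superadditive, and an element of [S] arises from few pairs: it has at most [N] prefixes,
    and left cancellation leaves one right factor for each. *)
Lemma mass_mul (S U V : seq X) a b (q : R) : 0 <= q -> uniq S -> uniq U -> uniq V ->
  {subset S <= G (a + b)%N} -> {subset U <= G a} -> {subset V <= G b} ->
  {in U & V, forall u v, u ** v \in S} ->
  mass U q * mass V q <= N%:R * mass S q.
Proof.
move=> q0 uS uU uV SG UG VG UV.
have -> : mass U q * mass V q =
    \sum_(y <- [seq (f, g) | f <- U, g <- V]) expR (q * (Y y.1 + Y y.2)).
  rewrite sum_allpairs /= /mass mulr_suml; apply: eq_bigr => f _.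
  rewrite !mulr_sumr; apply: eq_bigr => g _.
  by rewrite -!expRD; congr expR; ring.
apply: (@ler_sum_mult _ _ _ _ _ (fun y => y.1 ** y.2)) => //.
- move=> _ /allpairsP[[u v] /= [uU' vV ->]] /=; split; first exact: UV.
  by rewrite ler_expR ler_wpM2l//; apply: Y_mul; [exact: UG|exact: VG].
move=> h hS; have hG : h \in G (a + b)%N := SG _ hS.
apply: (leq_trans _ (prefixes_bound hG)).
apply: (@leq_trans (size [seq f <- U | has (fun g => f ** g == h) V])); last first.
  apply: uniq_leq_size; first exact: filter_uniq.
  move=> f; rewrite !mem_filter => /andP[/hasP[g gV e] fU].
  rewrite UG// andbT; apply/hasP; exists g => //; exact: VG.
rewrite size_filter.
have -> : count (fun f => has (fun g => f ** g == h) V) U =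
          count (fun f => (f \in U) && has (fun g => f ** g == h) V) U.
  by apply: eq_in_count => f ->.
have -> : count (fun y => y.1 ** y.2 == h) [seq (f, g) | f <- U, g <- V] =
    count (fun y => (y.1 \in U) && (y.1 ** y.2 == h)) [seq (f, g) | f <- U, g <- V].
  by apply: eq_in_count => _ /allpairsP[[u v] /= [Uu _ ->]] /=; rewrite Uu.
apply: (@count_allpairs_le _ _ _ _ (fun f g => (f \in U) && (f ** g == h))) => f.
have [fU|] := boolP (f \in U); last by move=> _; rewrite /= count_pred0.
rewrite /=; have [/hasP[g gV /eqP e]|/hasPn nV] := boolP (has _ _).
  rewrite (@eq_in_count _ _ (pred1 g)) ?count_uniq_mem ?leq_b1// => g' g'V /=.
  apply/eqP/eqP => [|->//]; rewrite -e => /(G_canL (UG _ fU) (VG _ g'V) (VG _ gV)).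
  by [].
by rewrite (@eq_in_count _ _ pred0) ?count_pred0// => g' /nV/negbTE.
Qed.

Lemma Z_le_mul n k (q : R) : 0 <= q ->
  mass (G (n + k)%N) q <= expR (q * c) * (mass (G n) q * mass (G k) q).
Proof. by move=> q0; apply: mass_cover => // h /Y_fact. Qed.

Lemma Z_ge_mul n k (q : R) : 0 <= q ->
  mass (G n) q * mass (G k) q <= N%:R * mass (G (n + k)%N) q.
Proof.
move=> q0; apply: (@mass_mul _ _ _ n k) => //.
by move=> u v uG vG; apply: G_mul.
Qed.

Lemma ln_mass_quasi_additive (q : R) n k : 0 <= q ->
  `|ln (mass (G (n + k)%N) q) - ln (mass (G n) q) - ln (mass (G k) q)| <=
  q * c + ln N%:R.
Proof.
move=> q0; have N0 : 0 < N%:R :> R by rewrite ltr0n.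
have lN : 0 <= ln N%:R :> R by rewrite ln_ge0// ler1n.
have qc : 0 <= q * c by rewrite mulr_ge0.
have := Z_le_mul n k q0; have := Z_ge_mul n k q0.
have m := mass_gt0 ^~ q.
rewrite -ler_ln ?posrE ?mulr_gt0// !lnM ?posrE// => h1.
rewrite -ler_ln ?posrE ?mulr_gt0 ?expR_gt0// !lnM ?posrE ?mulr_gt0 ?expR_gt0//
  expRK => h2.
by rewrite ler_norml; apply/andP; split; lra.
Qed.

Lemma pressure_exists : exists Pr : R -> R, forall q : R, 0 <= q -> forall n,
  `|ln (mass (G n) q) - n%:R * Pr q| <= q * c + ln N%:R.
Proof.
have /choice[Pr PrE] : forall q : R, exists p, 0 <= q -> forall n,
    `|ln (mass (G n) q) - n%:R * p| <= q * c + ln N%:R.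
  move=> q; have [q0|] := leP 0 q; last by move=> q0; exists 0.
  have [p hp] := quasi_additive_limit (fun n k => ln_mass_quasi_additive n k q0).
  by exists p.
by exists Pr.
Qed.

(** * Convexity of the pressure and synchronisation *)

Section Pressure.
Variable Pr : R -> R.
Hypothesis PrE : forall q : R, 0 <= q -> forall n,
  `|ln (mass (G n) q) - n%:R * Pr q| <= q * c + ln N%:R.

(** ln Z_n is convex for every [n] and differs from [n * Pr] by a bound independent of [n]; so [n]
    times the convexity defect stays bounded. *)
Lemma pressure_convex (a b x : R) : 0 < a -> 0 < b -> 0 <= x <= 1 ->
  Pr (x * a + (1 - x) * b) <= x * Pr a + (1 - x) * Pr b.
Proof.
move=> a0 b0 x01; set r := x * a + _.
have /andP[x0 x1] := x01.
have r0 : 0 <= r by apply: addr_ge0; apply: mulr_ge0 => //; lra.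
rewrite -subr_le0.
apply: (@le0_of_natr_mul_bounded _ _
  (r * c + ln N%:R + (x * (a * c + ln N%:R) + (1 - x) * (b * c + ln N%:R)))) => n.
have h : ln (mass (G n) r) <= x * ln (mass (G n) a) + (1 - x) * ln (mass (G n) b).
  exact: (ln_sum_expR_convex x01 (mass_gt0 n a) (mass_gt0 n b)).
have := PrE r0 n; have := PrE (ltW a0) n; have := PrE (ltW b0) n.
rewrite !ler_norml => /andP[_ hb] /andP[_ ha] /andP[hr _].
have := ler_wpM2l x0 ha.
have := ler_wpM2l (_ : 0 <= 1 - x) hb; rewrite subr_ge0 => /(_ x1).
by lra.
Qed.

(* Prefixing by [f0] and prolonging by [w], chosen so that [f0 ** w] has as many
   prefixes as possible at the level of [f0], synchronises all factorisations. *)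
Lemma synchronizing_word : exists a b f0 w, [/\ f0 \in G a, w \in G b &
  forall n k f u r z, f \in G n -> u \in G k -> r \in G (n + a)%N ->
    z \in G (b + k)%N -> r ** z = f ** (f0 ** w) ** u ->
    exists g g', [/\ g \in G a, g' \in G b, r = f ** g, g ** g' = f0 ** w
                   & z = g' ** u]].
Proof.
pose P m := `[< exists a b f w, [/\ f \in G a, w \in G b &
  size (prefixes a b (f ** w)) = m] >].
have exP : exists m, P m.
  have [f fG] := G_ex 0; exists (size (prefixes 0 0 (f ** f))).
  by apply/asboolP; exists 0%N, 0%N, f, f.
have ubP m : P m -> (m <= N)%N.
  by move=> /asboolP[a [b [f [w [fG wG <-]]]]]; apply/prefixes_bound/G_mul.
case: (ex_maxnP exP ubP) => m /asboolP[a [b [f0 [w [f0G wG mE]]]]] mmax.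
exists a, b, f0, w; split=> // n k f u r z fG uG rG zG e.
pose M := prefixes a b (f0 ** w).
have MG g : g \in M -> g \in G a by rewrite mem_filter => /andP[].
have ufM : uniq [seq f ** g | g <- M].
  rewrite map_inj_in_uniq ?filter_uniq// => g g' /MG gG /MG g'G.
  exact: (G_canL fG gG g'G).
pose h := f ** (f0 ** w) ** u.
have hE : h = (f ** f0) ** (w ** u) by rewrite /h !mulA.
have sM : {subset [seq f ** g | g <- M] <= prefixes (n + a)%N (b + k)%N h}.
  move=> _ /mapP[g gM ->]; have gG := MG _ gM; move: gM.
  rewrite !mem_filter => /andP[/hasP[g' g'G /eqP gg'] _].
  rewrite G_mul// andbT; apply/hasP; exists (g' ** u); first exact: G_mul.
  by rewrite /h -gg' !mulA.
have szh : (size (prefixes (n + a)%N (b + k)%N h) <= m)%N.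
  apply: mmax; apply/asboolP; exists (n + a)%N, (b + k)%N, (f ** f0), (w ** u).
  by rewrite -hE; split=> //; apply: G_mul.
(* The products [f ** g] are as many as the prefixes of [f0 ** w], which is the maximum, so they
   exhaust the prefixes of [h]. *)
have [|_ eqs] := uniq_min_size ufM sM; first by rewrite size_map mE.
have : r \in prefixes (n + a)%N (b + k)%N h.
  by rewrite mem_filter rG andbT; apply/hasP; exists z => //; rewrite e.
rewrite -eqs => /mapP[g gM rE]; have gG := MG _ gM; move: gM.
rewrite mem_filter => /andP[/hasP[g' g'G /eqP gg'] _].
exists g, g'; split=> //.
have guG : g' ** u \in G (b + k)%N by apply: G_mul.
by apply: (G_canL rG zG guG); rewrite e rE -gg' !mulA.
Qed.

Section Synchronized.
Variables (a b : nat) (e : X).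
Hypothesis eG : e \in G (a + b)%N.
Hypothesis sync : forall n k f u r z, f \in G n -> u \in G k ->
  r \in G (n + a)%N -> z \in G (b + k)%N -> r ** z = f ** e ** u ->
  exists g g', [/\ g \in G a, g' \in G b, r = f ** g, g ** g' = e
                 & z = g' ** u].

Let l := (a + b)%N.

Lemma Y_bounded_below (s : seq X) :
  exists2 m : R, 0 <= m & {in s, forall g, - m <= Y g}.
Proof.
elim: s => [|g s [m m0 IH]]; first by exists 0.
exists (m + `|Y g|); first by rewrite addr_ge0.
have := ler_norm (- Y g); rewrite normrN => Yg.
move=> h; rewrite inE => /orP[/eqP ->|/IH]; first by lra.
by have := normr_ge0 (Y g); lra.
Qed.

(** A cut inside [e] has factors in the finite levels [a] and [b], where [Y] is bounded below. For
    the last bound, cut [f ** e ** (e ** u)] optimally inside the first [e], then the right part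
    optimally inside the second: the first piece is compared with [f ** e], the last with [e ** u],
    and the middle one has [Y] at most 0. This is why [e] appears twice. *)
Lemma synchronized_bounds : exists m : R, [/\ 0 <= m, - m <= Y e,
  forall n k f u r z, f \in G n -> u \in G k -> r \in G (n + a)%N ->
    z \in G (b + k)%N -> r ** z = f ** e ** u -> Y r <= Y (f ** e) + m &
  forall n k f u, f \in G n -> u \in G k ->
    Y (f ** e ** (e ** u)) <= Y (f ** e) + Y (e ** u) + m].
Proof.
have c0 := c_ge0.
have [m m0 mY] := Y_bounded_below (e :: G a ++ G b).
have mYe : - m <= Y e by apply: mY; rewrite mem_head.
have mYa g : g \in G a -> - m <= Y g.
  by move=> gG; apply: mY; rewrite inE mem_cat gG orbT.
have mYb g : g \in G b -> - m <= Y g.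
  by move=> gG; apply: mY; rewrite inE mem_cat gG !orbT.
have prefE n f r g g' : f \in G n -> g \in G a -> g' \in G b -> r = f ** g ->
    g ** g' = e -> Y r <= Y (f ** e) + m.
  move=> fG gG g'G -> ge; have := Y_mul (G_mul fG gG) g'G.
  rewrite -mulA ge; have := mYb _ g'G; lra.
exists (m + (m + c + c)); split.
- by rewrite !addr_ge0.
- by lra.
- move=> n k f u r z fG uG rG zG rz.
  have [g [g' [gG g'G rE ge _]]] := sync fG uG rG zG rz.
  by have := prefE _ _ _ _ _ fG gG g'G rE ge; lra.
move=> n k f u fG uG.
have euG : e ** u \in G (l + k)%N by apply: G_mul.
have hG : f ** e ** (e ** u) \in G ((n + a) + (b + (l + k)))%N.
  rewrite (_ : (_ + _)%N = ((n + l) + (l + k))%N); last by rewrite /l !addnA.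
  by apply: G_mul => //; apply: G_mul.
have [r [z [rG zG rz Yh]]] := Y_fact hG.
have [g [g' [gG g'G rE ge zE]]] := sync fG euG rG zG rz.
have Yr := prefE _ _ _ _ _ fG gG g'G rE ge.
have zG' : g' ** e ** u \in G ((b + a) + (b + k))%N.
  rewrite -mulA (_ : (_ + _)%N = (b + (l + k))%N); last by rewrite /l !addnA.
  exact: G_mul.
have [r1 [z1 [r1G z1G rz1 Yz]]] := Y_fact zG'.
have [g1 [g1' [g1G g1'G rE1 ge1 zE1]]] := sync g'G uG r1G z1G rz1.
have := Y_mul g1G (G_mul g1'G uG); rewrite mulA ge1 => Yeu.
rewrite mulA in zE; rewrite zE1 in Yz; rewrite zE in Yh.
have := mYa _ g1G; have := Y_le0 r1G; lra.
Qed.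

(** The frame puts [e ** e] at every junction of two blocks, where [Y] is then additive up to a
    constant. For [n < l + l] the subtraction truncates and the elements have level [l + l] instead
    of [n]. *)
Definition blocks n := [seq e ** f ** e | f <- G (n - (l + l))%N].

Lemma blocksP n x : reflect
  (exists2 f, f \in G (n - (l + l))%N & x = e ** f ** e) (x \in blocks n).
Proof. by apply: (iffP mapP) => -[f fG ->]; exists f. Qed.

Lemma blocks_G n : (l + l <= n)%N -> {subset blocks n <= G n}.
Proof.
move=> ln _ /blocksP[f fG ->].
rewrite (_ : n = (l + (n - (l + l)) + l)%N); last lia.
by apply: G_mul => //; apply: G_mul.
Qed.

Lemma blocks_uniq n : uniq (blocks n).
Proof.
rewrite map_inj_in_uniq// => f g fG gG /(G_canR _ _ _) H.
apply: (G_canL eG fG gG); apply: H; [| |exact: eG].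
  exact: (G_mul eG fG).
exact: (G_mul eG gG).
Qed.

(** One constant serves a whole neighbourhood of [q], as exponents tending to [q] will be used.
    Framing costs a bounded factor: the levels given up weigh at most the size of [G (l + l)], and
    [Y e] is bounded below. *)
Lemma mass_bounds (q : R) : 0 < q -> exists2 C : R, 1 <= C &
  forall (q' : R) n, q / 2 <= q' <= 2 * q ->
  [/\ mass (G n) q' <= C * expR (n%:R * Pr q'),
      expR (n%:R * Pr q') <= C * mass (G n) q' &
      (l + l <= n)%N -> expR (n%:R * Pr q') <= C * mass (blocks n) q'].
Proof.
move=> q0.
have [m [m0 mYe _ _]] := synchronized_bounds.
pose s0 : R := (size (G (l + l)%N))%:R.
pose K := 2 * q * c + ln N%:R.
have lN : 0 <= ln N%:R :> R by rewrite ln_ge0// ler1n.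
have K0 : 0 <= K by rewrite addr_ge0// !mulr_ge0// ltW.
pose D := 2 * q * c + 4 * q * m.
have D0 : 0 <= D by rewrite addr_ge0// !mulr_ge0// ltW.
have eKD : 1 <= expR (K + D) by rewrite -expR0 ler_expR addr_ge0.
have s00 : 0 <= s0 by apply: ler0n.
exists (expR (K + D) * (s0 + 1)).
  by rewrite -[1]mulr1 ler_pM//; lra.
move=> q' n /andP[q1 q2].
have q'0 : 0 <= q' by lra.
have q'c : q' * c <= 2 * q * c by rewrite ler_wpM2r.
have := PrE q'0 n; rewrite ler_norml => /andP[h1 h2].
have M0 := mass_gt0 n q'.
have low : expR (n%:R * Pr q') <= expR K * mass (G n) q'.
  by rewrite -[mass _ _]lnK ?posrE// -expRD ler_expR /K; lra.
have eK1 : expR K <= expR (K + D) * (s0 + 1).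
  rewrite -[expR K]mulr1 ler_pM ?expR_ge0//; last lra.
  by rewrite ler_expR lerDl.
split.
- apply: (@le_trans _ _ (expR K * expR (n%:R * Pr q'))).
    by rewrite -[mass _ _]lnK ?posrE// -expRD ler_expR /K; lra.
  by rewrite ler_wpM2r ?expR_ge0.
- by apply: (le_trans low); rewrite ler_wpM2r// ltW.
move=> ln.
apply: (le_trans low).
have := Z_le_mul (n - (l + l))%N (l + l)%N q'0; rewrite subnK// => h3.
have h4 : mass (G (l + l)%N) q' <= s0.
  rewrite /mass /s0 -sum1_size natr_sum [leLHS]big_seq [leRHS]big_seq.
  apply: ler_sum => f fG; rewrite -expR0 ler_expR mulr_ge0_le0//.
  exact: (Y_le0 fG).
have h5 : expR (- (4 * q * m)) * mass (G (n - (l + l))%N) q' <= mass (blocks n) q'.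
  rewrite /mass big_map mulr_sumr [leLHS]big_seq [leRHS]big_seq.
  apply: ler_sum => f fG; rewrite -expRD ler_expR.
  have h6 := Y_mul (G_mul eG fG) eG; have h7 := Y_mul eG fG.
  have h8 : q' * (- (2 * m) + Y f) <= q' * Y (e ** f ** e) by rewrite ler_wpM2l//;
    lra.
  have h9 : q' * m <= 2 * q * m by rewrite ler_wpM2r.
  by lra.
rewrite (expRD K D) -!mulrA ler_wpM2l ?expR_ge0//.
apply: (le_trans h3).
have B0 := mass_ge0 (blocks n) q'.
have j0 := mass_ge0 (G (n - (l + l))%N) q'.
have h10 : mass (G (n - (l + l))%N) q' <= expR (4 * q * m) * mass (blocks n) q'.
  rewrite -(ler_pM2l (expR_gt0 (- (4 * q * m)))) mulrA -expRD addNr expR0 mul1r.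
  exact: h5.
apply: (@le_trans _ _ (expR (2 * q * c) * (expR (4 * q * m) * mass (blocks n)
  q' * (s0 + 1)))).
  apply: ler_pM; rewrite ?expR_ge0 ?mulr_ge0 ?mass_ge0 ?ler_expR//.
  by apply: ler_pM; rewrite ?mass_ge0//; lra.
by rewrite /D expRD le_eqVlt; apply/orP; left; apply/eqP; ring.
Qed.

Section AtExponent.
Variables (q C : R).
Hypothesis q0 : 0 < q.
Hypothesis C1 : 1 <= C.
Hypothesis massC : forall (q' : R) n, q / 2 <= q' <= 2 * q ->
  [/\ mass (G n) q' <= C * expR (n%:R * Pr q'),
      expR (n%:R * Pr q') <= C * mass (G n) q' &
      (l + l <= n)%N -> expR (n%:R * Pr q') <= C * mass (blocks n) q'].

(** Chernoff's bound: on the tail [1 <= expR (t * (Y r - y))], which moves the exponent from [q] to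
    [q + t]. *)
Lemma tail_mass n (t y : R) : 0 < t <= q ->
  mass [seq r <- G n | y <= Y r] q <= C * expR (n%:R * Pr (q + t) - t * y).
Proof.
have q0' := q0.
move=> /andP[t0 tq]; have [|h _ _] := @massC (q + t) n; first lra.
apply: (@le_trans _ _ (expR (- (t * y)) * mass (G n) (q + t))).
  rewrite /mass big_filter mulr_sumr [leRHS](bigID (fun r => y <= Y r))/=.
  rewrite ler_wpDr//; first by rewrite sumr_ge0// => ? _;
    rewrite mulr_ge0 ?expR_ge0.
  apply: ler_sum => r yr; rewrite -expRD ler_expR.
  by have := ler_wpM2l (ltW t0) yr; lra.
by rewrite expRD [_ * expR (- _)]mulrC mulrCA ler_wpM2l ?expR_ge0.
Qed.

(** [g] is a one-sided slope of [Pr] at [q] and [sg] selects the side. The tilt [u = s / n] with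
    [s = eta / eps] turns the band for [Y] into [|V| <= eta], and relative to [expR (n * Pr q)] it
    keeps the first moment of [expR V] bounded below and the second bounded above. *)
Lemma band (g sg eps : R) : sg = 1 \/ sg = -1 ->
  (forall t : R, 0 < t < q -> Pr q + sg * g * t <= Pr (q + sg * t)) ->
  (forall eps : R, 0 < eps -> exists2 t1 : R, 0 < t1 < q & forall t : R,
    0 < t <= t1 ->
    Pr (q + sg * t) <= Pr q + (sg * g + eps) * t) ->
  0 < eps -> exists n0, forall n, (n0 <= n)%N ->
  expR (n%:R * Pr q) / (4 * C ^+ 3) <=
    mass [seq f <- blocks n | `|Y f - n%:R * g| <= n%:R * eps] q.
Proof.
move=> sg1 lo hi eps0.
have C0 : 0 < C by have := C1; lra.
have q0' := q0.
pose eta := ln (12 * C ^+ 2).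
have C2 : 1 < 12 * C ^+ 2.
  have : 1 <= C ^+ 2 by rewrite exprn_ege1//; exact: C1.
  by lra.
have eta0 : 0 < eta by rewrite ln_gt0.
pose s := eta / eps.
have s0 : 0 < s by rewrite divr_gt0.
have l2 : 0 < ln 2 :> R by rewrite ln_gt0// ltr1n.
(* Multiplied by [n * (2 * u) = 2 * s], this slack becomes [ln 2]: the factor 2 allowed in the
   second moment. *)
have [|t1 /andP[t10 t1q] hit] := hi (ln 2 / (2 * s)).
  by rewrite divr_gt0// mulr_gt0.
pose T := Num.min t1 (q / 2).
have T0 : 0 < T by rewrite lt_min t10 /=; lra.
exists (maxn (l + l) (Num.bound (2 * s / T))).+1 => n nn.
have [ln1 ln2] : (l + l <= n /\ Num.bound (2 * s / T)%R < n)%N.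
  by move: nn; rewrite gtn_max => /andP[/ltnW ? ?].
have n0 : 0 < n%:R :> R by rewrite ltr0n (leq_ltn_trans _ ln2).
pose u := s / n%:R.
have u0 : 0 < u by rewrite divr_gt0.
have uT : 2 * u <= T.
  rewrite /u mulrA ler_pdivrMr// -ler_pdivrMl// mulrC ltW//.
  have h : 0 <= 2 * s / T.
    by apply: divr_ge0; [apply: mulr_ge0 => //|]; apply: ltW.
  by apply: (lt_trans (archi_boundP h)); rewrite ltr_nat.
move: uT; rewrite /T le_min => /andP[ut1 uq].
have nu : n%:R * u = s by rewrite /u mulrC divfK ?gt_eqF.
pose V f := sg * u * (Y f - n%:R * g).
have VE f : (`|V f| <= eta) = (`|Y f - n%:R * g| <= n%:R * eps).
  have sgn : `|sg| = 1 by case: sg1 => ->; rewrite ?normrN normr1.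
  rewrite /V normrM (normrM sg) sgn mul1r gtr0_norm// -(ler_pM2l n0) mulrA nu.
  by rewrite (_ : n%:R * eta = s * (n%:R * eps)) ?ler_pM2l// /s; field;
    rewrite gt_eqF.
have sgE x : sg * x = x \/ sg * x = - x.
  by case: sg1 => ->; [left; rewrite mul1r|right; rewrite mulN1r].
have A0 : 0 <= expR (n%:R * Pr q) by apply: expR_ge0.
rewrite /mass big_filter; under eq_bigl do rewrite -VE.
apply: (@band_mass _ _ _ (fun f => expR (q * Y f)) V) => //.
- have -> : \sum_(x <- blocks n) expR (q * Y x) * expR (V x) =
      expR (- (sg * u * (n%:R * g))) * mass (blocks n) (q + sg * u).
    rewrite /mass mulr_sumr; apply: eq_bigr => x _; rewrite -!expRD /V.
    by congr expR; ring.
  have [|_ _ /(_ ln1) h] := @massC (q + sg * u) n.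
    by have [->|->] := sgE u; lra.
  have := lo u ltac:(lra); rewrite -(ler_pM2l n0) => h'.
  have {}h : expR (n%:R * Pr q + n%:R * (sg * g * u)) <=
    C * mass (blocks n) (q + sg * u).
    by apply: le_trans h; rewrite ler_expR -mulrDr.
  have -> : expR (n%:R * Pr q) = expR (- (sg * u * (n%:R * g))) *
      expR (n%:R * Pr q + n%:R * (sg * g * u)).
    by rewrite -expRD; congr expR; ring.
  by rewrite ler_pdivrMr// -[leRHS]mulrA ler_wpM2l ?expR_ge0// [leRHS]mulrC.
- have -> : \sum_(x <- blocks n) expR (q * Y x) * expR (2 * V x) =
      expR (- (sg * (2 * u) * (n%:R * g))) * mass (blocks n) (q + sg * (2 * u)).
    rewrite /mass mulr_sumr; apply: eq_bigr => x _; rewrite -!expRD /V.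
    by congr expR; ring.
  have [|h _ _] := @massC (q + sg * (2 * u)) n.
    by have [->|->] := sgE (2 * u); lra.
  have {}h := le_trans (mass_sub _ (blocks_uniq n) (blocks_G ln1)) h.
  have := hit (2 * u) ltac:(lra); rewrite -(ler_pM2l n0) -ler_expR => h'.
  have {h'}h := le_trans h (ler_wpM2l (ltW C0) h').
  have -> : 2 * C * expR (n%:R * Pr q) = expR (- (sg * (2 * u) * (n%:R * g))) *
      (C * expR (n%:R * (Pr q + (sg * g + ln 2 / (2 * s)) * (2 * u)))).
    rewrite mulrCA -expRD.
    have -> : - (sg * (2 * u) * (n%:R * g))
      + n%:R * (Pr q + (sg * g + ln 2 / (2 * s)) * (2 * u)) =
       ln 2 + n%:R * Pr q by rewrite /u; field; rewrite !gt_eqF.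
    by rewrite expRD lnK ?posrE//; ring.
  by rewrite ler_wpM2l ?expR_ge0.
- have [|h _ _] := @massC q n; first lra.
  exact: le_trans (mass_sub _ (blocks_uniq n) (blocks_G ln1)) h.
- by rewrite /eta lnK// posrE; lra.
Qed.

(** * A low block after a typical beginning: one occurrence and two occurrences *)

Section Blocks.
Variables (al be eps : R) (n k : nat).

(** [D i] is the event of a beginning of slope [be] followed by a low block of slope [al]. The
    beginning is one framed block of length [(i + 1) n], not [i + 1] short ones: its mass is then
    bounded at once, with constants independent of [i]. *)
Let U i := [seq f <- blocks (i.+1 * n) |
  `|Y f - (i.+1 * n)%:R * be| <= (i.+1 * n)%:R * eps].
Let V := [seq f <- blocks n | `|Y f - n%:R * al| <= n%:R * eps].
Let D i h := `[< exists u v w, [/\ u \in U i, v \in V,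
  w \in G ((k - i.+1) * n)%N & u ** v ** w = h] >].

Hypothesis eps_ge0 : 0 <= eps.
Hypothesis ln : (l + l <= n)%N.

Let lin i : (l + l <= i.+1 * n)%N.
Proof. by rewrite (leq_trans ln)// leq_pmull. Qed.

Let UG i : {subset U i <= G (i.+1 * n)%N}.
Proof. by move=> f; rewrite mem_filter => /andP[_ /(blocks_G (lin i))]. Qed.

Let VG : {subset V <= G n}.
Proof. by move=> f; rewrite mem_filter => /andP[_ /(blocks_G ln)]. Qed.

Let levelE i : (i < k)%N -> (i.+1 * n + n + (k - i.+1) * n = k.+1 * n)%N.
Proof. by move=> ik; rewrite addnAC -mulnDl subnKC// addnC mulSn. Qed.

(** Each of the two bands costs [4 * C ^+ 3], the free tail [C], and each of the two products
    [N]. *)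
Lemma mass_dip i : (i < k)%N ->
  expR ((i.+1 * n)%:R * Pr q) / (4 * C ^+ 3) <= mass (U i) q ->
  expR (n%:R * Pr q) / (4 * C ^+ 3) <= mass V q ->
  expR ((k.+1 * n)%:R * Pr q) / (16 * C ^+ 7 * N%:R ^+ 2) <=
  mass [seq h <- G (k.+1 * n)%N | D i h] q.
Proof.
move=> ik hU hV; have C0 : 0 < C by rewrite (lt_le_trans _ C1).
have q0' := q0; have N0 : 0 < N%:R :> R by rewrite ltr0n.
pose S1 := undup [seq u ** v | u <- U i, v <- V].
have S1G : {subset S1 <= G (i.+1 * n + n)%N}.
  move=> x; rewrite mem_undup => /allpairsP[[u v] /= [uU vV ->]].
  by apply: G_mul; [apply: UG uU|apply: VG].
have h1 : mass (U i) q * mass V q <= N%:R * mass S1 q.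
  apply: (@mass_mul _ _ _ (i.+1 * n)%N n);
    rewrite ?undup_uniq ?filter_uniq ?blocks_uniq ?ltW//.
  by move=> u v uU vV; rewrite mem_undup; apply/allpairsP; exists (u, v).
have h2 : mass S1 q * mass (G ((k - i.+1) * n)%N) q <=
    N%:R * mass [seq h <- G (k.+1 * n)%N | D i h] q.
  apply: (@mass_mul _ _ _ (i.+1 * n + n)%N ((k - i.+1) * n)%N);
    rewrite ?undup_uniq ?filter_uniq ?ltW//.
  - by move=> h; rewrite levelE// mem_filter => /andP[].
  - move=> x w xS wG; rewrite mem_filter -(levelE ik) G_mul ?S1G// andbT.
    move: xS; rewrite mem_undup => /allpairsP[[u v] /= [uU vV ->]].
    by apply/asboolP; exists u, v, w.
have [|_ h3 _] := @massC q ((k - i.+1) * n)%N; first lra.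
have h4 : (expR ((i.+1 * n)%:R * Pr q) / (4 * C ^+ 3)) * (expR (n%:R * Pr q)
  / (4 * C ^+ 3)) <=
    mass (U i) q * mass V q.
  by apply: ler_pM => //; rewrite divr_ge0 ?expR_ge0// mulr_ge0// exprn_ge0// ltW.
have h5 : mass (U i) q * mass V q * mass (G ((k - i.+1) * n)%N) q <=
    N%:R ^+ 2 * mass [seq h <- G (k.+1 * n)%N | D i h] q.
  rewrite expr2 -[leRHS]mulrA; apply: (le_trans _ (ler_wpM2l (ltW N0) h2)).
  by rewrite [leRHS]mulrA; apply: ler_wpM2r => //; apply: mass_ge0.
have h6 : (expR ((i.+1 * n)%:R * Pr q) / (4 * C ^+ 3)) * (expR (n%:R * Pr q)
  / (4 * C ^+ 3)) *
    (expR (((k - i.+1) * n)%:R * Pr q) / C) <=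
    mass (U i) q * mass V q * mass (G ((k - i.+1) * n)%N) q.
  apply: ler_pM => //.
  - by rewrite mulr_ge0// divr_ge0 ?expR_ge0// mulr_ge0// exprn_ge0// ltW.
  - by rewrite divr_ge0 ?expR_ge0// ltW.
  - by rewrite ler_pdivrMr// [leRHS]mulrC.
have := le_trans h6 h5.
have -> : expR ((k.+1 * n)%:R * Pr q) =
  expR ((i.+1 * n)%:R * Pr q) * expR (n%:R * Pr q) *
   expR (((k - i.+1) * n)%:R * Pr q).
  by rewrite -!expRD -!mulrDl -!natrD levelE.
rewrite -ler_pdivrMl ?exprn_gt0//; apply: le_trans.
by rewrite le_eqVlt; apply/orP; left; apply/eqP; field; rewrite !gt_eqF.
Qed.

Variable m : R.
Hypothesis m0 : 0 <= m.
Hypothesis Y_sync : forall n k f u r z, f \in G n -> u \in G k ->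
  r \in G (n + a)%N -> z \in G (b + k)%N -> r ** z = f ** e ** u ->
  Y r <= Y (f ** e) + m.
Hypothesis Y_quasi : forall n k f u, f \in G n -> u \in G k ->
  Y (f ** e ** (e ** u)) <= Y (f ** e) + Y (e ** u) + m.

(* If the last low block before position [i.+2 * n] were followed at [j.+1 * n]
   by a prefix of typical size, the piece in between would be too heavy. *)
Lemma two_dips i j h : (i < j < k)%N -> D i h -> D j h -> exists r r' z,
  [/\ r \in G (i.+2 * n - l + a)%N, r' \in G ((j - i.+1) * n + b)%N,
      z \in G ((k - j) * n)%N, r ** r' ** z = h /\ Y h <=
        Y r + Y r' + Y z + (c + m) &
      n%:R * ((j - i.+1)%:R * be + (be - al) - 2 * k%:R * eps) - (c + 2 * m) <= Y r'
      ].
Proof.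
move=> /andP[ij jk] /asboolP[u [v [w [uU vV wG huvw]]]].
move=> /asboolP[u' [v' [w' [uU' vV' wG' huvw']]]].
have uG := UG uU; have vG := VG vV; have uG' := UG uU'; have vG' := VG vV'.
move: uU uU' vV vV'; rewrite !mem_filter.
move=> /andP[bu /blocksP[f1 f1G uE]].
move=> /andP[bu' /blocksP[f2 f2G uE']].
move=> /andP[bv /blocksP[f3 f3G vE]].
move=> /andP[bv' /blocksP[f4 f4G vE']].
(* [y] is [u ** v] without its last [e], inside which [h] is going to be cut. *)
pose y := u ** (e ** f3).
have yG : y \in G (i.+2 * n - l)%N.
  by rewrite (level_head i ln); apply: G_mul => //; apply: G_mul.
have hy : h = y ** e ** w by rewrite /y -huvw vE !mulA.
rewrite (level_split ij ln) in uG'.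
(* This cut of [u'] falls inside the last [e] of [v]. Synchronisation bounds [Y r] by [Y u + Y v] up
   to a constant, which is low, so [r'] has to make up for the typical size of [u']. *)
have [r [r' [rG r'G rr' Yu']]] := Y_fact uG'.
have [zG0 zG1] : v' ** w' \in G (n + (k - j.+1) * n)%N /\ v' ** w' \in G ((k - j)
  * n)%N.
  by rewrite (level_tail n jk); split => //; apply: G_mul.
have hz : r ** (r' ** (v' ** w')) = y ** e ** w by rewrite -hy -huvw' -rr' !mulA.
have rzG : r' ** (v' ** w') \in G (b + (k - i.+1) * n)%N.
  by rewrite -(level_rest n b ij jk); apply: G_mul.
have Yr := Y_sync yG wG rG rzG hz.
have Yuv : Y (y ** e) <= Y u + Y v + m.
  have := Y_quasi (G_mul eG f1G) (G_mul f3G eG).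
  by rewrite -!uE /y vE !mulA.
have Yh : Y h <= Y u' + Y (v' ** w') + m.
  have := Y_quasi (G_mul eG f2G) (G_mul (G_mul f4G eG) wG').
  by rewrite -huvw' uE' vE' !mulA.
exists r, r', (v' ** w'); split => //; first by split;
  [rewrite -huvw' -rr' !mulA|lra].
move: bu bu' bv; rewrite !ler_norml => /andP[_ bu] /andP[bu' _] /andP[_ bv].
have ijE : (j%:R : R) = i.+1%:R + (j - i.+1)%:R by rewrite -natrD subnKC.
have n0 : 0 <= n%:R :> R by apply: ler0n.
(* The band errors of [u], [v] and [u'] are [i + 1], [1] and [j + 1] times [n * eps]. *)
have jik : (j + i + 3)%:R * eps <= 2 * k%:R * eps.
  apply: ler_wpM2r; first exact: eps_ge0.
  by rewrite -natrM ler_nat; apply: level_count ij jk.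
have := ler_wpM2l n0 jik.
move: bu bu' bv; rewrite !natrM !natrD -[j.+1%:R]natr1 ijE -!natr1.
by move: Yu' Yr Yuv Yh; lra.
Qed.

(** Of the three factors only the middle one is restricted: its threshold exceeds the typical
    [mid * be] by about [n * (be - al)]. The Chernoff bound turns this excess into the gain; the
    other terms of the exponent collect errors. *)
Lemma mass_two_dips i j t : (i < j < k)%N -> eps <= 1 -> 0 < t <= q ->
  Pr (q + t) <= Pr q + (be + eps) * t ->
  mass [seq h <- G (k.+1 * n)%N | D i h && D j h] q <=
  expR (q * (c + m)) * C ^+ 3 * expR ((k.+1 * n)%:R * Pr q) *
  expR (t * (- (n%:R * (be - al)) + 3 * k%:R * n%:R * eps +
             (b%:R * (`|be| + 1) + c + 2 * m))).
Proof.
move=> /[dup] ijk /andP[ij jk] eps1 /[dup] tq /andP[t0 _] Prt.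
have C0 : 0 < C by rewrite (lt_le_trans _ C1).
have q0' := q0.
set B := b%:R * _ + c + 2 * m.
pose lr := (i.+2 * n - l + a)%N; pose mid := ((j - i.+1) * n + b)%N.
pose lz := ((k - j) * n)%N.
pose y := n%:R * ((j - i.+1)%:R * be + (be - al) - 2 * k%:R * eps) - (c + 2 * m).
have lev : (lr + mid + lz = k.+1 * n)%N by apply: level_total ij jk ln.
have [|hr _ _] := @massC q lr; first lra.
have [|hz _ _] := @massC q lz; first lra.
have hm := @tail_mass mid t y tq.
have : mass [seq h <- G (k.+1 * n)%N | D i h && D j h] q <=
    expR (q * (c + m)) * (mass (G lr) q * mass [seq r <- G mid | y <= Y r]
      q * mass (G lz) q).
  apply: mass_cover3; rewrite ?filter_uniq ?ltW// => h.
  rewrite mem_filter => /andP[/andP[Di Dj] _].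
  have [r [r' [z [rG r'G zG [e1 e2] yr]]]] := two_dips ijk Di Dj.
  by exists r, r', z; split => //; rewrite mem_filter yr.
move=> /le_trans; apply.
set Ex := expR (t * _).
rewrite -!mulrA ler_wpM2l ?expR_ge0//.
have kn : mid%:R * eps <= (k%:R * n%:R + b%:R) * eps.
  apply: ler_wpM2r; first exact: eps_ge0.
  rewrite -natrM -natrD ler_nat leq_add2r leq_mul2r (leq_trans (leq_subr _ _))
    ?orbT//.
  exact: ltnW.
have be' := ler_norm be.
have bb : b%:R * be <= b%:R * `|be| by rewrite ler_wpM2l.
have beps : b%:R * eps <= b%:R * 1 by rewrite ler_wpM2l.
have hexp : mid%:R * Pr (q + t) - t * y <= mid%:R * Pr q +
    t * (- (n%:R * (be - al)) + 3 * k%:R * n%:R * eps + B).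
  have h1 : mid%:R * Pr (q + t) <=
    mid%:R * (Pr q + (be + eps) * t) by rewrite ler_wpM2l.
  have h2 : t * (mid%:R * (be + eps) - y) <=
      t * (- (n%:R * (be - al)) + 3 * k%:R * n%:R * eps + B).
    rewrite (ler_pM2l t0) /y /B.
    have midE : mid%:R * be = n%:R * ((j - i.+1)%:R * be) + b%:R * be.
      by rewrite /mid natrD natrM; ring.
    by rewrite mulrDr midE; lra.
  by lra.
apply: (@le_trans _ _ ((C * expR (lr%:R * Pr q)) *
    (C * expR (mid%:R * Pr q + t * (- (n%:R * (be - al))
      + 3 * k%:R * n%:R * eps + B))) *
    (C * expR (lz%:R * Pr q)))).
  rewrite mulrA; apply: ler_pM; rewrite ?mulr_ge0 ?mass_ge0//.
  apply: ler_pM; rewrite ?mass_ge0//; apply: (le_trans hm).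
  by rewrite (ler_pM2l C0) ler_expR.
rewrite [expR (_ + t * _)]expRD -/Ex -lev !natrD !mulrDl !expRD.
by rewrite le_eqVlt; apply/orP; left; apply/eqP; ring.
Qed.

Lemma mass_dips_le :
  \sum_(i < k) mass [seq h <- G (k.+1 * n)%N | D i h] q <=
  mass (G (k.+1 * n)%N) q +
  \sum_(i < k) \sum_(j < k | (i < j)%N)
    mass [seq h <- G (k.+1 * n)%N | D i h && D j h] q.
Proof.
have filterE (P : pred X) : mass [seq h <- G (k.+1 * n)%N | P h] q =
    \sum_(h <- G (k.+1 * n)%N) expR (q * Y h) * (P h)%:R.
  rewrite /mass big_filter big_mkcond; apply: eq_bigr => h _.
  by case: ifP; rewrite ?mulr1 ?mulr0.
under eq_bigr do rewrite filterE.
under [X in _ <= _ + X]eq_bigr do under eq_bigr do rewrite filterE.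
rewrite exchange_big/=; under [X in _ <= _ + X]eq_bigr do rewrite exchange_big/=.
rewrite [X in _ <= _ + X]exchange_big/= /mass -big_split/=; apply: ler_sum => h _.
have := ler_wpM2l (expR_ge0 (q * Y h)) (sum_bool_pairs R (fun i : 'I_k => D i h)).
rewrite mulrDr mulr1 !mulr_sumr => /le_trans; apply; rewrite lerD2l.
by apply: ler_sum => i _; rewrite mulr_sumr.
Qed.

(** The total mass is at most [C * A], while single events and pairs have the shares of [A] found
    above; dividing by [A] leaves an inequality between constants. *)
Lemma dips_bound t (A := expR ((k.+1 * n)%:R * Pr q)) :
  eps <= 1 -> 0 < t <= q -> Pr (q + t) <= Pr q + (be + eps) * t ->
  (forall i, (i < k)%N ->
     expR ((i.+1 * n)%:R * Pr q) / (4 * C ^+ 3) <= mass (U i) q) ->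
  expR (n%:R * Pr q) / (4 * C ^+ 3) <= mass V q ->
  k%:R / (16 * C ^+ 7 * N%:R ^+ 2) <= C + k%:R ^+ 2 *
    (expR (q * (c + m)) * C ^+ 3 *
     expR (t * (- (n%:R * (be - al)) + 3 * k%:R * n%:R * eps +
             (b%:R * (`|be| + 1) + c + 2 * m)))).
Proof.
move=> eps1 tq Prt hU hV; set E := expR (t * _).
have A0 : 0 < A by apply: expR_gt0.
have q0' := q0.
have C0 : 0 < C by rewrite (lt_le_trans _ C1).
rewrite -(ler_pM2l A0).
have [|hG _ _] := @massC q (k.+1 * n)%N; first lra.
set F := expR (q * (c + m)) * C ^+ 3 * E.
have F0 : 0 <= F 
  by apply: mulr_ge0; [apply: mulr_ge0|]; rewrite ?expR_ge0 ?exprn_ge0 ?ltW.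
apply: (@le_trans _ _ (\sum_(i < k) mass [seq h <- G (k.+1 * n)%N | D i h] q)).
  have -> : A * (k%:R / (16 * C ^+ 7 * N%:R ^+ 2)) =
      \sum_(i < k) (A / (16 * C ^+ 7 * N%:R ^+ 2)).
    by rewrite sumr_const card_ord -[RHS]mulr_natl mulrCA.
  by apply: ler_sum => i _; apply: mass_dip => //; apply: hU.
apply: (le_trans mass_dips_le); rewrite mulrDr lerD//.
  by rewrite mulrC.
apply: (@le_trans _ _ (\sum_(i < k) \sum_(j < k) (A * F))).
  apply: ler_sum => i _; rewrite big_mkcond; apply: ler_sum => j _.
  case: ifP => ij; last by rewrite mulr_ge0 ?expR_ge0.
  have ijk : (i < j < k)%N by rewrite ij ltn_ord.
  apply: (le_trans (mass_two_dips ijk eps1 tq Prt)).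
  by rewrite /F le_eqVlt; apply/orP; left; apply/eqP; rewrite -/E -/A; ring.
rewrite !sumr_const card_ord -mulrnA -[leLHS]mulr_natl natrM -expr2.
by rewrite le_eqVlt; apply/orP; left; apply/eqP; ring.
Qed.

End Blocks.

End AtExponent.

Lemma synchronized_pressure_derivable (q : R) : 0 < q -> derivable Pr q 1.
Proof.
move=> q0.
have [al [be [albe hr hl heps]]] := convex_slopes q0 pressure_convex.
have [alE|ne] := eqVneq al be; first by subst; exact: derivable_slopes hr hl heps.
exfalso; have {albe ne} kap0 : 0 < be - al by rewrite subr_gt0 lt_neqAle ne.
have [C C1 massC] := mass_bounds q0.
have [m [m0 _ Ysync Yquasi]] := synchronized_bounds.
have C0 : 0 < C by rewrite (lt_le_trans _ C1).
have N0 : 0 < N%:R :> R by rewrite ltr0n.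
pose c3 := 16 * C ^+ 7 * N%:R ^+ 2.
have c30 : 0 < c3 by rewrite !mulr_gt0 ?exprn_gt0.
(* The overlaps will contribute at most 1, so [k / c3 > C + 2] is contradictory. *)
pose k := (Num.bound ((C + 2) * c3)).+1.
have hk : C + 2 < k%:R / c3.
  have h : 0 <= (C + 2) * c3 by apply: mulr_ge0; apply: ltW => //; apply: addr_gt0.
  by rewrite ltr_pdivlMr//; apply: (lt_trans (archi_boundP h)); rewrite ltr_nat.
have k0 : 0 < k%:R :> R by rewrite ltr0n.
pose F := expR (q * (c + m)) * C ^+ 3.
have F0 : 0 < F by rewrite mulr_gt0 ?expR_gt0 ?exprn_gt0.
pose W := k%:R ^+ 2 * F.
have W0 : 0 < W by rewrite mulr_gt0 ?exprn_gt0.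
(* The gain [s * (be - al)] pays for [ln W] and leaves 2: one unit for the error [3 * k * s * eps],
   one for [t * B]. *)
pose s := (2 + `|ln W|) / (be - al).
have s0 : 0 < s by apply: divr_gt0 => //; have := normr_ge0 (ln W); lra.
pose eps := Num.min 1 (1 / (3 * k%:R * s)).
have D0 : 0 < 3 * k%:R * s by apply: mulr_gt0 => //; apply: mulr_gt0.
have eps0 : 0 < eps by rewrite lt_min ltr01 divr_gt0.
have eps1 : eps <= 1 by rewrite ge_min lexx.
have epss : 3 * k%:R * s * eps <= 1.
  by rewrite mulrC -ler_pdivlMr// ge_min lexx orbT.
have [n1 band_be] : exists n0, forall n, (n0 <= n)%N ->
    expR (n%:R * Pr q) / (4 * C ^+ 3) <=
    mass [seq f <- blocks n | `|Y f - n%:R * be| <= n%:R * eps] q.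
  apply: (@band q C q0 C1 massC be 1) => //; first by left.
  - by move=> t tq; rewrite !mul1r; apply: hr.
  - move=> d d0; have [t1 t1q h] := heps _ d0; exists t1 => // t tt.
    by rewrite !mul1r; have [] := h t tt.
have [n2 band_al] : exists n0, forall n, (n0 <= n)%N ->
    expR (n%:R * Pr q) / (4 * C ^+ 3) <=
    mass [seq f <- blocks n | `|Y f - n%:R * al| <= n%:R * eps] q.
  apply: (@band q C q0 C1 massC al (-1)) => //; first by right.
  - by move=> t tq; rewrite !mulN1r mulNr; apply: hl.
  - move=> d d0; have [t1 t1q h] := heps _ d0; exists t1 => // t tt.
    by rewrite !mulN1r; have [_] := h t tt; lra.
have [t1 /andP[t10 t1q] ht1] := heps _ eps0.
pose B := b%:R * (`|be| + 1) + c + 2 * m.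
have c0 := c_ge0.
have B0 : 0 <= B.
  by rewrite /B !addr_ge0// ?mulr_ge0// addr_ge0.
(* [n] exceeds the thresholds of both bands, leaves room for the frames, and makes [t = s / n] small
   enough for [t <= t1] and [t * B <= 1]. *)
pose n := (maxn (maxn n1 n2) (maxn (l + l) (Num.bound (s * (B + 1 / t1))))).+1.
have nn1 : (n1 <= n)%N by rewrite /n -maxnA ltnW// ltnS leq_max leqnn.
have nn2 : (n2 <= n)%N by rewrite /n (maxnC n1) -maxnA ltnW// ltnS leq_max leqnn.
have nl : (l + l <= n)%N.
  by rewrite /n (maxnC (maxn n1 n2)) -maxnA ltnW// ltnS leq_max leqnn.
have n0 : 0 < n%:R :> R by rewrite ltr0n.
have nB : s * (B + 1 / t1) < n%:R.
  have h : 0 <= s * (B + 1 / t1).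
    by apply: mulr_ge0; [exact: ltW|apply: addr_ge0 => //; apply: divr_ge0 => //;
      exact: ltW].
  apply: (lt_trans (archi_boundP h)); rewrite ltr_nat.
  by rewrite /n ltnS maxnA leq_max leqnn orbT.
have sB : s * B < n%:R.
  by apply: le_lt_trans nB; rewrite ler_pM2l// lerDl ltW// divr_gt0.
have st1 : s / t1 < n%:R.
  by apply: le_lt_trans nB; rewrite ler_pM2l// div1r lerDr.
pose t := s / n%:R.
have t0 : 0 < t by rewrite divr_gt0.
have tt1 : t <= t1 by rewrite ler_pdivrMr// mulrC -ler_pdivrMr// ltW.
have tn : t * n%:R = s by rewrite /t divfK ?gt_eqF.
have tq : 0 < t <= q by rewrite t0 (le_trans tt1)// ltW.
have Prt : Pr (q + t) <= Pr q + (be + eps) * t.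
  by have [] := ht1 t; rewrite ?t0.
have := dips_bound (k := k) q0 C1 massC (ltW eps0) nl Ysync Yquasi eps1 tq Prt.
move=> /(_ al) H.
have {}H := H _ (band_al _ nn2).
have := H (fun i _ => band_be _ (leq_trans nn1 (leq_pmull _ _))).
rewrite -/c3 -/F -/B mulrA -/W => {}H.
suff : W * expR (t * (- (n%:R * (be - al)) + 3 * k%:R * n%:R * eps + B)) <= 1.
  by move: (H (fun i => ltn0Sn i)) hk; lra.
rewrite -[W]lnK ?posrE// -expRD -[leRHS]expR0 ler_expR.
have -> : t * (- (n%:R * (be - al)) + 3 * k%:R * n%:R * eps + B) =
   - (t * n%:R * (be - al)) + 3 * k%:R * (t * n%:R) * eps + t * B by ring.
rewrite tn.
have -> : s * (be - al) = 2 + `|ln W| by rewrite /s divfK ?gt_eqF.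
have : t * B <= 1 by rewrite /t mulrAC ler_pdivrMr// mul1r ltW.
have := ler_norm (ln W); move: epss; lra.
Qed.

End Synchronized.

Lemma pressure_derivable (q : R) : 0 < q -> derivable Pr q 1.
Proof.
move=> q0; have [a [b [f0 [w [f0G wG sync]]]]] := synchronizing_word.
by apply: (@synchronized_pressure_derivable a b (f0 ** w)) => //; apply: G_mul.
Qed.

End Pressure.

Lemma pressure_differentiable : exists Pr : R -> R,
  (forall q : R, 0 <= q -> forall n,
    `|ln (mass (G n) q) - n%:R * Pr q| <= q * c + ln N%:R) /\
  (forall q : R, 0 < q -> derivable Pr q 1).
Proof.
have [Pr PrE] := pressure_exists.
by exists Pr; split=> // q; apply: pressure_derivable PrE q.
Qed.

End GradedMonoid.

(** * Euclidean norm and similitudes *)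

Section EuclideanNorm.
Variables (R : realType) (d : nat).
Implicit Types x y z : 'rV[R]_d.

Definition edot x y : R := \sum_(i < d) x ord0 i * y ord0 i.

Lemma enorm_ge0 x : 0 <= enorm x. Proof. exact: sqrtr_ge0. Qed.

Lemma sqr_enorm x : enorm x ^+ 2 = edot x x.
Proof.
rewrite sqr_sqrtr; last by apply: sumr_ge0 => i _; apply: sqr_ge0.
by apply: eq_bigr => i _; rewrite expr2.
Qed.

Lemma enorm0 : enorm (0 : 'rV[R]_d) = 0.
Proof. by rewrite /enorm big1 ?sqrtr0// => i _; rewrite mxE expr0n. Qed.

Lemma enormN x : enorm (- x) = enorm x.
Proof. by congr Num.sqrt; apply: eq_bigr => i _; rewrite mxE sqrrN. Qed.

Lemma enormB x y : enorm (x - y) = enorm (y - x).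
Proof. by rewrite -enormN opprB. Qed.

Lemma enorm_eq0 x : (enorm x == 0) = (x == 0).
Proof.
apply/eqP/eqP => [x0|->]; last exact: enorm0.
have : edot x x == 0 by rewrite -sqr_enorm x0 expr0n.
rewrite psumr_eq0 => [/allP H|i _]; last by rewrite -expr2 sqr_ge0.
apply/rowP => i; have := H i; rewrite mem_index_enum => /(_ isT).
by rewrite /= mxE mulf_eq0 orbb => /eqP.
Qed.

Lemma edotDr x y z : edot x (y + z) = edot x y + edot x z.
Proof. by rewrite -big_split; apply: eq_bigr => i _; rewrite mxE mulrDr. Qed.

Lemma edotC x y : edot x y = edot y x.
Proof. by apply: eq_bigr => i _; rewrite mulrC. Qed.

Lemma edotNr x y : edot x (- y) = - edot x y.
Proof. by rewrite -sumrN; apply: eq_bigr => i _; rewrite mxE mulrN. Qed.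

Lemma edotZr (k : R) x y : edot x (k *: y) = k * edot x y.
Proof. by rewrite mulr_sumr; apply: eq_bigr => i _; rewrite mxE mulrCA. Qed.

Lemma edotZl (k : R) x y : edot (k *: x) y = k * edot x y.
Proof. by rewrite edotC edotZr edotC. Qed.

Lemma edot_sqrD x y : enorm (x + y) ^+ 2 =
  enorm x ^+ 2 + enorm y ^+ 2 + 2 * edot x y.
Proof.
rewrite !sqr_enorm edotDr !(edotC (x + y)) !edotDr (edotC y x).
by ring.
Qed.

Lemma edot_sqrB x y : enorm (x - y) ^+ 2 =
  enorm x ^+ 2 + enorm y ^+ 2 - 2 * edot x y.
Proof. by rewrite edot_sqrD enormN edotNr mulrN. Qed.

Lemma enormZ (k : R) x : enorm (k *: x) = `|k| * enorm x.
Proof.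
apply/eqP; rewrite -(@eqrXn2 _ 2) ?mulr_ge0 ?enorm_ge0//.
by rewrite exprMn !sqr_enorm edotZr edotZl mulrA -expr2 real_normK ?num_real.
Qed.

(** Cauchy-Schwarz: expand the squared norm of a multiple of the component of [x] orthogonal to
    [y]. *)
Lemma edot_le x y : edot x y <= enorm x * enorm y.
Proof.
have [y0|yn0] := eqVneq (enorm y) 0.
  move/eqP: (y0); rewrite enorm_eq0 => /eqP ->.
  by rewrite /edot big1 ?mulr_ge0 ?enorm_ge0// => i _; rewrite mxE mulr0.
have yp : 0 < enorm y by rewrite lt_def yn0 enorm_ge0.
rewrite (le_trans (ler_norm _))// -(@ler_pXn2r _ 2) ?nnegrE ?mulr_ge0 ?enorm_ge0//.
rewrite exprMn real_normK ?num_real//.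
have := sqr_ge0 (enorm (enorm y ^+ 2 *: x - edot x y *: y)).
rewrite edot_sqrB !enormZ !exprMn edotZr edotZl.
rewrite !real_normK ?num_real//.
set A := enorm x; set B := enorm y; set D := edot x y.
have -> : (B ^+ 2) ^+ 2 * A ^+ 2 + D ^+ 2 * B ^+ 2 - 2 * (D * (B ^+ 2 * D)) =
   B ^+ 2 * (A ^+ 2 * B ^+ 2 - D ^+ 2) by ring.
by rewrite pmulr_rge0 ?exprn_gt0// subr_ge0.
Qed.

Lemma ler_enormD x y : enorm (x + y) <= enorm x + enorm y.
Proof.
rewrite -(@ler_pXn2r _ 2) ?nnegrE ?addr_ge0 ?enorm_ge0//.
rewrite edot_sqrD; have := edot_le x y.
have -> : (enorm x + enorm y) ^+ 2 =
  enorm x ^+ 2 + enorm y ^+ 2 + 2 * (enorm x * enorm y) by ring.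
by lra.
Qed.

Lemma enorm_triangle y x z : enorm (x - z) <= enorm (x - y) + enorm (y - z).
Proof.
by rewrite (_ : x - z = (x - y) + (y - z)) ?ler_enormD// addrA subrK.
Qed.

Lemma norm_le_enorm x : `|x| <= enorm x.
Proof.
rewrite [leLHS]/Num.norm/= mx_normrE; apply/bigmax_leP; split;
  first exact: enorm_ge0.
move=> [i j] _ /=; rewrite (ord1 i).
rewrite -(@ler_pXn2r _ 2) ?nnegrE ?enorm_ge0// real_normK ?num_real//.
rewrite sqr_enorm /edot (bigD1 j)//= -expr2 lerDl sumr_ge0// => k _.
exact: sqr_ge0.
Qed.

Lemma enorm_le_norm x : enorm x <= d%:R * `|x|.
Proof.
rewrite -(@ler_pXn2r _ 2) ?nnegrE ?mulr_ge0 ?enorm_ge0//.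
rewrite sqr_enorm exprMn (@le_trans _ _ (\sum_(i < d) `|x| ^+ 2))//.
  apply: ler_sum => i _; rewrite -expr2 -[leLHS]real_normK ?num_real//.
  rewrite ler_pXn2r ?nnegrE// [leRHS]/Num.norm/= mx_normrE.
  by apply/bigmax_geP; right; exists (ord0, i).
rewrite sumr_const card_ord -[leLHS]mulr_natl ler_wpM2r ?sqr_ge0// -natrX ler_nat.
by case: d => // k; rewrite leq_pmulr.
Qed.

Lemma enorm_lipschitz x y : `|enorm x - enorm y| <= enorm (x - y).
Proof.
rewrite ler_norml; apply/andP; split.
  have := ler_enormD (y - x) x; rewrite subrK (enormB y x); lra.
by have := ler_enormD (x - y) y; rewrite subrK; lra.
Qed.

Lemma continuous_of_elipschitz (f : 'rV[R]_d -> 'rV[R]_d) (k : R) : 0 < k ->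
  (forall x y, enorm (f x - f y) <= k * enorm (x - y)) -> continuous f.
Proof.
move=> k0 fk x; apply: (@cvgrPdist_lt _ _ _ (nbhs x) (nbhs_filter x) f (f x)).2 =>
  /= e e0.
have k1 : 0 < k * (d%:R + 1) by rewrite mulr_gt0// ltr_wpDl.
apply: (@nbhs_normP R 'rV[R]_d x _).2; exists (e / (k * (d%:R + 1)));
  first exact: divr_gt0.
move=> y /=; rewrite ltr_pdivlMr// => xy.
rewrite (le_lt_trans (norm_le_enorm _))// (le_lt_trans (fk _ _))//.
apply: le_lt_trans xy; rewrite mulrCA ler_pM2l//.
by rewrite (le_trans (enorm_le_norm _))// mulrC ler_wpM2l// lerDl.
Qed.

Lemma continuous_enorm : continuous (@enorm R d).
Proof.
move=> x; apply: (@cvgrPdist_lt _ _ _ (nbhs x) (nbhs_filter x) _ _).2 => /= e e0.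
have k1 : 0 < d%:R + 1 :> R by rewrite ltr_wpDl.
apply: (@nbhs_normP R 'rV[R]_d x _).2; exists (e / (d%:R + 1));
  first exact: divr_gt0.
move=> y /=; rewrite ltr_pdivlMr// => xy.
rewrite (le_lt_trans (enorm_lipschitz _ _))//.
apply: le_lt_trans xy.
by rewrite (le_trans (enorm_le_norm _))// mulrC ler_wpM2l// lerDl.
Qed.

Lemma closed_cball x (r : R) : closed (cball x r).
Proof.
change (closed ((fun y => enorm (y - x)) @^-1` [set t | t <= r])).
apply: closed_comp; last exact: closed_le.
move=> y _; apply: continuous_comp; last exact: continuous_enorm.
apply: (@continuous_of_elipschitz (fun y => y - x) 1) => // u v.
by rewrite mul1r opprB addrA subrK.
Qed.

End EuclideanNorm.

(** * Bijectivity of similitudes *)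

Section Similitudes.
Variables (R : realType) (d : nat).
Implicit Types (x y : 'rV[R]_d) (f g : 'rV[R]_d -> 'rV[R]_d).

Lemma similitude_id : similitude 1 (@id 'rV[R]_d).
Proof. by split=> // x y; rewrite mul1r. Qed.

Lemma similitude_comp (r s : R) f g :
  similitude r f -> similitude s g -> similitude (r * s) (f \o g).
Proof.
move=> [r0 fr] [s0 gs]; split; first exact: mulr_gt0.
by move=> x y; rewrite fr gs mulrA.
Qed.

Lemma similitude_inj (r : R) f : similitude r f -> injective f.
Proof.
move=> [r0 fr] x y fxy; have := fr x y; rewrite fxy subrr enorm0 => /esym/eqP.
by rewrite mulf_eq0 gt_eqF//= enorm_eq0 subr_eq0 => /eqP.
Qed.

Lemma similitude_continuous (r : R) f : similitude r f -> continuous f.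
Proof.
by move=> [r0 fr]; apply: (continuous_of_elipschitz r0) => x y; rewrite fr.
Qed.

(** Inner products are preserved, so the images of the standard basis are the rows of an orthogonal
    matrix [A]; then [g x] is [x *m A], and [y *m A^T] is a preimage of [y]. *)
Lemma isometry_surj g : (forall x y, enorm (g x - g y) = enorm (x - y)) ->
  g 0 = 0 -> forall y, exists x, g x = y.
Proof.
move=> iso g0.
have nrm x : enorm (g x) = enorm x by have := iso x 0; rewrite g0 !subr0.
have dt x y : edot (g x) (g y) = edot x y.
  have : enorm (g x - g y) ^+ 2 = enorm (x - y) ^+ 2 by rewrite iso.
  by rewrite !edot_sqrB !nrm; lra.
pose A := \matrix_(i < d) g (delta_mx ord0 i).
have eE x (y : 'rV[R]_d) i : (x *m A^T) ord0 i = edot x (g (delta_mx ord0 i)).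
  by rewrite mxE; apply: eq_bigr => j _; rewrite !mxE.
have dotd x i : edot x (delta_mx ord0 i) = x ord0 i.
  rewrite /edot (bigD1 i)//= big1 ?addr0 ?mxE ?eqxx ?mulr1// => j ji.
  by rewrite mxE (negbTE ji) mulr0.
have AAT : A *m A^T = 1%:M.
  apply/matrixP => i j.
  have -> : (A *m A^T) i j = edot (g (delta_mx ord0 i)) (g (delta_mx ord0 j)).
    by rewrite mxE; apply: eq_bigr => k _; rewrite !mxE.
  by rewrite dt dotd !mxE eqxx /= eq_sym.
have ATA := mulmx1C AAT.
have gA x : g x *m A^T = x.
  by apply/rowP => i; rewrite eE// dt dotd.
move=> y; exists (y *m A^T).
by rewrite -[LHS]mulmx1 -ATA mulmxA gA -mulmxA ATA mulmx1.
Qed.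

Lemma similitude_surj (r : R) f : similitude r f -> forall y, exists x, f x = y.
Proof.
move=> [r0 fr] y; pose g x := r^-1 *: (f x - f 0).
have [||x gx] := @isometry_surj g _ _ (r^-1 *: (y - f 0)).
- move=> u v; rewrite /g -scalerBr opprB addrA subrK enormZ fr mulrA.
  by rewrite gtr0_norm ?invr_gt0// mulVf ?mul1r// gt_eqF.
- by rewrite /g subrr scaler0.
exists x; apply: (@addIr _ (- f 0)).
by apply: (@scalerI _ _ r^-1) => //; rewrite invr_eq0 gt_eqF.
Qed.

Lemma pinv_similitude (r : R) f : similitude r f -> forall y, f (pinv setT f y) = y.
Proof.
by move=> fr y; apply: pinvK; rewrite inE; have [x <-] := similitude_surj fr y;
  exists x.
Qed.

End Similitudes.

(** * Words and the finite type condition *)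

Section SeqFacts.
Variable (R : realType).

Lemma finite_uniform_pos (T : eqType) (s : seq T) (P : T -> R -> Prop) :
  (forall x e e', 0 < e' <= e -> P x e -> P x e') ->
  {in s, forall x, exists2 e : R, 0 < e & P x e} ->
  exists2 e : R, 0 < e & {in s, forall x, P x e}.
Proof.
move=> mon; elim: s => [|x s IH] H; first by exists 1.
have [|e e0 eP] := IH; first by move=> y ys; apply: H; rewrite inE ys orbT.
have [e' e'0 e'P] := H x (mem_head _ _).
exists (Num.min e e'); first by rewrite lt_min e0.
move=> y; rewrite inE => /orP[/eqP ->|ys].
  by apply: mon e'P; rewrite lt_min e0 e'0 ge_min lexx orbT.
by apply: mon (eP _ ys); rewrite lt_min e0 e'0 ge_min lexx.
Qed.

Lemma exists_expr_le (rho s e : R) : 0 < rho < 1 -> 0 < e ->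
  exists n, s * rho ^+ n <= e.
Proof.
move=> /andP[rho0 rho1] e0; have [s0|s0] := leP s 0.
  by exists 0%N; rewrite expr0 mulr1 (le_trans s0)// ltW.
have := @cvg_expr R rho; rewrite ger0_norm ?ltW// => /(_ rho1) cv.
have es : 0 < e / s by rewrite divr_gt0.
have := (@cvgrPdist_lt _ _ _ _ _ _ _).1 cv _ es.
move=> [k _ /(_ k (leqnn _)) /=]; rewrite sub0r normrN ger0_norm ?exprn_ge0 ?ltW//.
by rewrite ltr_pdivlMr// mulrC => ?; exists k; apply: ltW.
Qed.

Lemma sum_le_size_max (T : eqType) (s : seq T) (F : T -> R) : s != [::] ->
  exists2 x, x \in s & \sum_(y <- s) F y <= (size s)%:R * F x.
Proof.
case: s => // x s _; elim: s x => [|y s IH] x.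
  by exists x; rewrite ?mem_head// big_seq1 mul1r.
have [z zs H] := IH y.
have [xz|zx] := leP (F x) (F z).
  exists z; first by rewrite inE zs orbT.
  by rewrite big_cons [leRHS]/= -natr1 mulrDl mul1r addrC lerD.
exists x; rewrite ?mem_head// big_cons [leRHS]/= -natr1 mulrDl mul1r addrC lerD//.
by rewrite (le_trans H)// ler_wpM2l// ltW.
Qed.

Lemma sum_fibers (T T' : eqType) (s : seq T') (t : seq T) (phi : T -> T')
    (P : pred T) (F : T -> R) : uniq s -> {in t, forall u, phi u \in s} ->
  \sum_(u <- t | P u) F u = \sum_(f <- s) \sum_(u <- t | P u && (phi u == f)) F u.
Proof.
move=> us ts; rewrite (exchange_big_dep P)/=; last by move=> ? ? _ /andP[].
rewrite big_seq_cond [RHS]big_seq_cond; apply: eq_bigr => u /andP[ut Pu].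
rewrite -big_filter (_ : [seq f <- s | _] = [:: phi u]) ?big_seq1//.
rewrite Pu /= (@eq_filter _ _ (pred1 (phi u))); last by move=> f /=; rewrite eq_sym.
by rewrite filter_pred1_uniq ?ts.
Qed.

End SeqFacts.

Section Words.
Variable m : nat.

Fixpoint words n : seq (seq 'I_m) :=
  if n is n'.+1 then [seq i :: w | i <- enum 'I_m, w <- words n'] else [:: [::]].

Lemma mem_words n w : (w \in words n) = (size w == n).
Proof.
elim: n w => [|n IH] w /=; first by rewrite inE size_eq0.
apply/allpairsP/idP => [[[i v] /= [_ vn ->]]|]; first by rewrite /= eqSS -IH.
by case: w => // i w; rewrite /= eqSS -IH => wn; exists (i, w); rewrite mem_enum.
Qed.

Lemma size_words n : size (words n) = (m ^ n)%N.
Proof. by elim: n => //= n IH; rewrite size_allpairs IH size_enum_ord expnS. Qed.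

Lemma sum_words_cat (R : realType) n k (P : pred (seq 'I_m)) (F : seq 'I_m -> R) :
  \sum_(w <- words (n + k) | P w) F w =
  \sum_(u <- words n) \sum_(v <- words k | P (u ++ v)) F (u ++ v).
Proof.
elim: n P F => [|n IH] P F; first by rewrite big_seq1.
rewrite addSn [LHS]big_mkcond /= [LHS]big_allpairs_dep [RHS]big_allpairs_dep /=.
by apply: eq_bigr => i _; rewrite -big_mkcond IH.
Qed.

Lemma sum_words_prod (R : realType) n (p : 'I_m -> R) : \sum_(i < m) p i = 1 ->
  \sum_(w <- words n) \prod_(i <- w) p i = 1.
Proof.
move=> p1; elim: n => [|n IH]; first by rewrite big_seq1 big_nil.
rewrite [LHS]big_allpairs_dep /= -[RHS]p1 -big_enum /=; apply: eq_bigr => i _.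
under eq_bigr do rewrite big_cons.
by rewrite -mulr_sumr IH mulr1.
Qed.

End Words.

(** * Nearby pieces of one level have finitely many relative positions *)

Section FiniteType.
Variables (R : realType) (d m : nat).
Notation rV := 'rV[R]_d.
Variables (S : 'I_m -> rV -> rV) (K : set rV) (rho : R).
Hypothesis simS : forall i, similitude rho (S i).
Hypothesis rho0 : 0 < rho.
Hypothesis rho1 : rho < 1.
Hypothesis KS : self_similar_set S K.
Hypothesis ftcS : finite_type_condition S K.

Lemma word_map_cat I J : word_map S (I ++ J) = word_map S I \o word_map S J.
Proof. by elim: I => //= i I ->. Qed.

Lemma word_map_similitude I : similitude (rho ^+ size I) (word_map S I).
Proof.
elim: I => [|i I IH] /=; first by rewrite expr0; apply: similitude_id.
by rewrite exprS; apply: similitude_comp.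
Qed.

Lemma word_map_K I x : K x -> K (word_map S I x).
Proof.
have [_ _ KE] := KS; elim: I x => //= i I IH x Kx.
by rewrite KE; exists i => //; exists (word_map S I x) => //; apply: IH.
Qed.

Lemma K_word n x : K x -> exists2 w, w \in words m n & exists2 y,
  K y & word_map S w y = x.
Proof.
have [_ _ KE] := KS.
elim: n x => [|n IH] x; first by move=> Kx; exists [::]; rewrite ?mem_words//;
  exists x.
rewrite {1}KE => -[i _ [y Ky <-]].
have [w wn [z Kz <-]] := IH y Ky.
by exists (i :: w); [rewrite mem_words /= eqSS -mem_words|exists z].
Qed.

Lemma K_bounded : exists2 D : R, 0 < D & forall x y, K x -> K y ->
  enorm (x - y) <= D.
Proof.
have [[x0 Kx0] cK _] := KS.
pose f y := enorm (y - x0).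
have cf : continuous f.
  move=> y; apply: continuous_comp; last exact: continuous_enorm.
  apply: (@continuous_of_elipschitz _ _ (fun y => y - x0) 1) => // u v.
  by rewrite mul1r opprB addrA subrK.
have [|y _ fy] := @compact_EVT_max _ _ f K _ cK (continuous_subspaceT cf);
  first by exists x0.
exists (2 * f y + 1); first by have := enorm_ge0 (y - x0); rewrite /f; lra.
move=> x z Kx Kz; apply: (le_trans (enorm_triangle x0 _ _)).
have := fy x; have := fy z; rewrite !inE => /(_ Kz) fz /(_ Kx) fx.
by rewrite (enormB x0); move: fx fz; rewrite /f; lra.
Qed.

(** The distance attains its minimum over pairs of points of [K]. If it is 0 the images meet;
    otherwise half of it separates them. *)
Lemma compact_separation (f g : rV -> rV) (k : R) : 0 < k ->
  (forall x y, enorm (f x - f y) <= k * enorm (x - y)) ->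
  (forall x y, enorm (g x - g y) <= k * enorm (x - y)) ->
  exists2 e : R, 0 < e & forall x y, K x -> K y -> enorm (f x - g y) <= e ->
    exists x' y', [/\ K x', K y' & f x' = g y'].
Proof.
have [[x0 Kx0] cK _] := KS.
move=> k0 fk gk; pose F (z : rV * rV) := enorm (f z.1 - g z.2).
have cF : continuous F.
  move=> z; apply: (@cvgrPdist_lt _ _ _ (nbhs z) (nbhs_filter z) F (F z)).2 => e e0.
  have e0' : 0 < e / (2 * k) by rewrite divr_gt0// mulr_gt0.
  pose q y := [set w : rV | enorm (y - w) < e / (2 * k)].
  have nq y : nbhs y (q y).
    have h : continuous (fun w : rV => enorm (y - w)).
      move=> w; apply: continuous_comp; last exact: continuous_enorm.
      apply: (@continuous_of_elipschitz _ _ (fun w => y - w) 1) => // u v.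
      by rewrite mul1r opprB addrC addrA subrK enormB.
    have := (@cvgrPdist_lt _ _ _ (nbhs y) (nbhs_filter y) _ _).1 (h y) _ e0'.
    apply: filterS => w; rewrite subrr enorm0 sub0r normrN /q /=.
    by apply: le_lt_trans; apply: ler_norm.
  exists (q z.1, q z.2); first by split; apply: nq.
  move=> [w1 w2] /= [q1 q2].
  apply: (le_lt_trans (enorm_lipschitz _ _)).
  have -> : f z.1 - g z.2 - (f w1 - g w2) = (f z.1 - f w1) + (g w2 - g z.2).
    by rewrite opprB addrCA addrA [RHS]addrC -!addrA; congr (_ + _); rewrite addrCA.
  apply: (le_lt_trans (ler_enormD _ _)).
  have := fk z.1 w1; have := gk w2 z.2; rewrite (enormB w2).
  move: q1 q2; rewrite /q /= !ltr_pdivlMr ?mulr_gt0//.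
  lra.
have [||[x y] xyK H] := @compact_EVT_min _ _ F (K `*` K)
  _ _ (continuous_subspaceT cF).
- by exists (x0, x0).
- exact: compact_setX.
move: xyK; rewrite inE => -[/= Kx Ky].
have [F0|Fn0] := eqVneq (F (x, y)) 0.
  exists 1 => // _ _ _ _ _; exists x, y; split => //.
  by move/eqP: F0; rewrite enorm_eq0 subr_eq0 => /eqP.
have F0 : 0 < F (x, y) by rewrite lt_def Fn0 enorm_ge0.
exists (F (x, y) / 2) => [|u v Ku Kv]; first exact: divr_gt0.
have := H (u, v); rewrite inE => /(_ (conj Ku Kv)); rewrite {2}/F /=.
by lra.
Qed.

(** For [L = 0] the two images of [K] meet, which is the case governed by the finite type
    condition. *)
Definition near_maps n (L : R) (f g : rV -> rV) :=
  exists x y, [/\ K x, K y & enorm (f x - g y) <= L * rho ^+ n].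

Lemma near_maps_parent n L I J i j :
  near_maps n.+1 L (word_map S (rcons I i)) (word_map S (rcons J j)) ->
  near_maps n (L * rho) (word_map S I) (word_map S J).
Proof.
move=> [x [y [Kx Ky]]]; rewrite -!cats1 !word_map_cat /= exprS mulrA => h.
by exists (S i x), (S j y); split => //; apply: (@word_map_K [:: _]).
Qed.

Lemma intersecting_types : exists G : seq (rV -> rV), forall n I J,
  size I = n -> size J = n -> near_maps n 0 (word_map S I) (word_map S J) ->
  exists2 g, g \in G & word_map S J = word_map S I \o g.
Proof.
have [Gam [/finite_seqP[G ->] H]] := ftcS.
(* [id] serves the empty words, as the finite type condition concerns positive lengths. *)
exists (id :: G) => n I J sI sJ [x [y [Kx Ky]]].
rewrite mul0r => xy.
have {}xy : word_map S I x = word_map S J y.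
  by apply/eqP; rewrite -subr_eq0 -enorm_eq0 eq_le xy enorm_ge0.
case: n sI sJ => [|n] sI sJ.
  by exists id; rewrite ?mem_head// (size0nil sI) (size0nil sJ).
have [e|g] := H n.+1 (Tuple (introT eqP sI)) (Tuple (introT eqP sJ)) isT.
  suff : (set0 : set rV) (word_map S I x) by [].
  by rewrite -e; split; [exists x|exists y].
exists (pinv setT (word_map S I) \o word_map S J); first by rewrite inE g orbT.
by apply/funext => z /=; rewrite (pinv_similitude (word_map_similitude I)).
Qed.

(** Induction on the level. Close pieces have parents close within [e * rho <= e], which therefore
    meet and have one of finitely many relative positions [g]. With the last letters [i] and [j]
    this leaves finitely many configurations up to a similitude, and compactness gives each of them
    a gap. *)
Lemma near_intersect : exists2 e : R, 0 < e & forall n I J, size I = n ->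
  size J = n ->
  near_maps n e (word_map S I) (word_map S J) ->
  near_maps n 0 (word_map S I) (word_map S J).
Proof.
have [G HG] := intersecting_types.
pose P (z : (rV -> rV) * ('I_m * 'I_m)) (e : R) := forall n I J, size I = n ->
  size J = n ->
  word_map S J = word_map S I \o z.1 ->
  near_maps n.+1 e (word_map S (rcons I z.2.1)) (word_map S (rcons J z.2.2)) ->
  near_maps n.+1 0 (word_map S (rcons I z.2.1)) (word_map S (rcons J z.2.2)).
have [|z _|e e0 HP] := @finite_uniform_pos R _
    [seq (g, ij) | g <- G, ij <- enum [set: 'I_m * 'I_m]%SET] P.
- move=> z e e' /andP[e'0 ee'] Pz n I J sI sJ IJ [x [y [Kx Ky xy]]].
  apply: Pz IJ _ => //; exists x, y; split => //.
  by apply: (le_trans xy); rewrite ler_wpM2r// exprn_ge0// ltW.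
(* A position that never occurs imposes nothing. One that occurs is an isometry, as words of equal
   length have equal ratios. *)
- have [[n [I [J [sI sJ IJ]]]]|no] := pselect (exists n I J, [/\ size I = n,
  size J = n &
     word_map S J = word_map S I \o z.1]); last first.
    exists 1 => // n I J sI sJ IJ; exfalso; apply: no; exists n, I, J; split => //.
  have gE x y : enorm (z.1 x - z.1 y) = enorm (x - y).
    have [r0 hI] := word_map_similitude I; have [_ hJ] := word_map_similitude J.
    have := hJ x y; rewrite IJ /= hI sI sJ; apply: mulfI.
    by rewrite gt_eqF// exprn_gt0.
  have [||e e0 He] := @compact_separation (S z.2.1) (z.1 \o S z.2.2) rho rho0.
  - by move=> x y; have [_ ->] := simS z.2.1.
  - by move=> x y /=; rewrite gE; have [_ ->] := simS z.2.2.
  exists e => // n' I' J' sI' sJ' IJ' [x [y [Kx Ky]]].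
  have hI := word_map_similitude I'.
  rewrite -!cats1 !word_map_cat /= IJ' /= (hI.2 _ _) sI' exprS => h.
  have {}h : enorm (S z.2.1 x - (z.1 \o S z.2.2) y) <= e.
    have rn : 0 < rho ^+ n' by apply: exprn_gt0.
    rewrite -(ler_pM2l rn) (le_trans h)// [leRHS]mulrC mulrA ler_wpM2r ?(ltW rn)//.
    by rewrite ler_piMr ?ltW.
  have [x' [y' [Kx' Ky' xy']]] := He _ _ Kx Ky h.
  exists x', y'; split => //=; rewrite mul0r.
  by rewrite -[z.1 _]xy' subrr enorm0.
exists e => //; elim=> [|n IH] I J.
  move=> sI sJ _; rewrite (size0nil sI) (size0nil sJ).
  have [[x0 Kx0] _ _] := KS.
  by exists x0, x0; split => //; rewrite subrr enorm0 mul0r.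
case/lastP: I => // I i; case/lastP: J => // J j.
rewrite !size_rcons => -[sI] [sJ] nIJ.
have [x [y [Kx Ky xy]]] := near_maps_parent nIJ.
have /(HG _ _ _ sI sJ)[g gG IJ] : near_maps n 0 (word_map S I) (word_map S J).
  apply: IH => //; exists x, y; split => //; apply: (le_trans xy).
  apply: ler_wpM2r; first by rewrite exprn_ge0// ltW.
  by rewrite ler_piMr// ltW.
apply: (HP (g, (i, j))) IJ nIJ => //.
by apply/allpairsP; exists (g, (i, j)); rewrite mem_enum inE.
Qed.

(** [k] levels up, [L] shrinks to at most [e], so the ancestors meet and have one of finitely many
    relative positions; this position and the last [k] letters determine the map. Words shorter than
    [k] are counted directly. *)
Lemma near_count (L : R) : exists N : nat, forall n I (s : seq (rV -> rV)),
  size I = n -> uniq s ->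
  {in s, forall f, exists2 J, size J = n & f =
    word_map S J /\ near_maps n L (word_map S I) f} ->
  (size s <= N)%N.
Proof.
have [e e0 He] := near_intersect; have [G HG] := intersecting_types.
have [k Lk] : exists k, L * rho ^+ k <= e by apply: exists_expr_le => //;
  rewrite rho0.
have near_anc n j L' I J I' J' : size I' = j -> size J' = j ->
    near_maps (n + j)%N L' (word_map S (I ++ I')) (word_map S (J ++ J')) ->
    near_maps n (L' * rho ^+ j) (word_map S I) (word_map S J).
  elim: j L' I' J' => [|j IH] L' I' J'.
    by move=> /size0nil -> /size0nil ->; rewrite addn0 !cats0 expr0 mulr1.
  case/lastP: I' => // I' i; case/lastP: J' => // J' i'.
  rewrite !size_rcons => -[sI] [sJ]; rewrite addnS -!rcons_cat => /near_maps_parent.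
  by move=> /(IH _ _ _ sI sJ); rewrite exprS mulrA.
exists (size G * m ^ k + \sum_(j < k) m ^ j)%N => n I s sI us Hs.
have [nk|kn] := ltnP n k.
  apply: (@leq_trans (m ^ n)); last first.
    by rewrite (bigD1 (Ordinal nk))//= addnCA leq_addr.
  rewrite -size_words -(size_map (word_map S));
    apply: uniq_leq_size => // f /Hs[J sJ [-> _]].
  by apply: map_f; rewrite mem_words sJ.
apply: (@leq_trans (size G * m ^ k)); last exact: leq_addr.
rewrite -size_words -(size_allpairs (fun g v =>
  word_map S (take (n - k) I) \o g \o word_map S v)).
apply: uniq_leq_size => // f /Hs[J sJ [-> nIJ]].
have sI' : size (drop (n - k) I) = k by rewrite size_drop sI subKn.
have sJ' : size (drop (n - k) J) = k by rewrite size_drop sJ subKn.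
have tI : size (take (n - k) I) = (n - k)%N by rewrite size_takel// sI leq_subr.
have tJ : size (take (n - k) J) = (n - k)%N by rewrite size_takel// sJ leq_subr.
have : near_maps (n - k) (L * rho ^+ k) (word_map S (take (n - k) I))
  (word_map S (take (n - k) J)).
  by apply: near_anc sI' sJ' _; rewrite !cat_take_drop subnK.
move=> [x [y [Kx Ky xy]]].
have nr : near_maps (n - k) e (word_map S (take (n - k) I))
  (word_map S (take (n - k) J)).
  exists x, y; split => //; apply: (le_trans xy); apply: ler_wpM2r => //.
  by rewrite exprn_ge0 ?ltW.
have [g gG gE] := HG _ _ _ tI tJ (He _ _ _ tI tJ nr).
apply/allpairsP; exists (g, drop (n - k) J); split => //;
  first by rewrite mem_words sJ'.
by rewrite -{1}(cat_take_drop (n - k) J) word_map_cat gE.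
Qed.

End FiniteType.

(** * The monoid of level maps and their weights *)

Section LevelMaps.
Variables (R : realType) (d m : nat).
Notation rV := 'rV[R]_d.
Variables (S : 'I_m -> rV -> rV) (K : set rV) (rho : R) (p : 'I_m -> R).
Hypothesis simS : forall i, similitude rho (S i).
Hypothesis rho0 : 0 < rho.
Hypothesis rho1 : rho < 1.
Hypothesis KS : self_similar_set S K.
Hypothesis ftcS : finite_type_condition S K.
Hypothesis probp : probability_vector p.

(** Words with the same map are identified: exact overlaps would otherwise make the number of nearby
    pieces unbounded. *)
Definition level_maps n : seq (rV ->
  rV) := undup [seq word_map S w | w <- words m n].

Definition weight (w : seq 'I_m) : R := \prod_(i <- w) p i.

Definition map_weight n (f : rV -> rV) : R :=
  \sum_(w <- words m n | word_map S w == f) weight w.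

Lemma level_mapsP n f :
  reflect (exists2 w, size w = n & f = word_map S w) (f \in level_maps n).
Proof.
rewrite mem_undup; apply: (iffP mapP) => -[w wn ->]; exists w => //.
  by apply/eqP; rewrite -mem_words.
by rewrite mem_words wn.
Qed.

Lemma word_map_level w n : w \in words m n -> word_map S w \in level_maps n.
Proof. by move=> wn; rewrite mem_undup map_f. Qed.

Lemma weight_gt0 w : 0 < weight w.
Proof. by have [p0 _] := probp; rewrite /weight; apply: prodr_gt0. Qed.

Lemma map_weight_gt0 n f : f \in level_maps n -> 0 < map_weight n f.
Proof.
move=> /level_mapsP[w wn ->]; have wW : w \in words m n by rewrite mem_words wn.
rewrite /map_weight big_mkcond (perm_big _ (perm_to_rem wW)) big_cons eqxx /=.
rewrite ltr_pwDl ?weight_gt0// sumr_ge0// => u _.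
by case: ifP => // _; rewrite ltW// weight_gt0.
Qed.

Lemma map_weight_ge0 n f : 0 <= map_weight n f.
Proof. by rewrite sumr_ge0// => w _; rewrite ltW// weight_gt0. Qed.

Lemma map_weight_le1 n f : map_weight n f <= 1.
Proof.
have [_ p1] := probp; rewrite -(sum_words_prod n p1) /map_weight.
rewrite [leRHS](bigID (fun w => word_map S w == f))/= ler_wpDr// sumr_ge0// => w _.
by rewrite ltW// weight_gt0.
Qed.

Lemma map_weight_add n k h : map_weight (n + k) h =
  \sum_(f <- level_maps n) \sum_(g <- level_maps k | f \o g == h)
    map_weight n f * map_weight k g.
Proof.
rewrite /map_weight sum_words_cat.
rewrite (@sum_fibers _ _ _ (level_maps n) _ (word_map S)) ?undup_uniq//; last first.
  by move=> u; apply: word_map_level.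
apply: eq_bigr => f _ /=.
have E u : word_map S u == f -> \sum_(v <- words m k | word_map S (u ++ v) ==
  h) weight (u ++ v) =
    weight u * \sum_(g <- level_maps k | f \o g == h) map_weight k g.
  move=> /eqP uf; rewrite (@sum_fibers _ _ _ (level_maps k) _ (word_map S))
    ?undup_uniq//; last first.
    by move=> v; apply: word_map_level.
  rewrite mulr_sumr [RHS]big_mkcond; apply: eq_bigr => g _ /=.
  case: ifP => fgh; last first.
    rewrite big1// => v /andP[/eqP e /eqP vg]; move: fgh.
    by rewrite -e word_map_cat uf vg eqxx.
  rewrite /map_weight mulr_sumr; apply: eq_big => v.
    case: (eqVneq (word_map S v) g) => [vg|_]; last by rewrite andbF.
    by rewrite word_map_cat uf vg fgh.
  by move=> _; rewrite /weight big_cat.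
rewrite (eq_bigr _ E) -mulr_suml mulr_sumr; apply: eq_bigr => g _.
by [].
Qed.

Lemma map_weight_mul n k f g : f \in level_maps n -> g \in level_maps k ->
  map_weight n f * map_weight k g <= map_weight (n + k) (f \o g).
Proof.
move=> fn gk; rewrite map_weight_add (perm_big _ (perm_to_rem fn)) big_cons /=.
rewrite ler_wpDr//.
  by rewrite !sumr_ge0// => ? _; rewrite sumr_ge0// => ? _;
    rewrite mulr_ge0 ?map_weight_ge0.
rewrite big_mkcond (perm_big _ (perm_to_rem gk)) big_cons /= eqxx.
rewrite ler_wpDr// sumr_ge0// => ? _.
by case: ifP => // _; rewrite mulr_ge0 ?map_weight_ge0.
Qed.

Lemma level_maps_similitude n f : f \in level_maps n -> similitude (rho ^+ n) f.
Proof. by move=> /level_mapsP[w <- ->]; apply: word_map_similitude. Qed.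

Lemma level_maps_near_count (L : R) : exists N : nat, forall n f (s : seq (rV ->
  rV)),
  f \in level_maps n -> uniq s ->
  {in s, forall g, g \in level_maps n /\ near_maps K rho n L f g} ->
    (size s <= N)%N.
Proof.
have [N H] := near_count simS rho0 rho1 KS ftcS L.
exists N => n _ s /level_mapsP[w wn ->] us Hs; apply: (H n w) => // g /Hs[].
by move=> /level_mapsP[u un ->] h; exists u.
Qed.

Lemma level_factor n k h : h \in level_maps (n + k) ->
  exists f g, [/\ f \in level_maps n, g \in level_maps k & f \o g = h].
Proof.
move=> /level_mapsP[w wn ->]; exists (word_map S (take n w)),
  (word_map S (drop n w)).
split; last by rewrite -word_map_cat cat_take_drop.
  by apply/level_mapsP; exists (take n w); rewrite ?size_takel// wn leq_addr.
by apply/level_mapsP; exists (drop n w); rewrite ?size_drop// wn addKn.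
Qed.

(** A map is tagged with its level because its weight is a sum over words of that length. *)
Let X := (nat * (rV -> rV))%type.
Let mul (x y : X) : X := ((x.1 + y.1)%N, x.2 \o y.2).
Let G n : seq X := [seq (n, f) | f <- level_maps n].
Let Y (x : X) : R := ln (map_weight x.1 x.2).

Let GP n x : reflect (x.1 = n /\ x.2 \in level_maps n) (x \in G n).
Proof.
apply: (iffP mapP) => [[f fn ->]//|]; case: x => k f /= [<- fn]; by exists f.
Qed.

Definition level_sum n (q : R) :=
  \sum_(f <- level_maps n) expR (q * ln (map_weight n f)).

(** Left cancellation is injectivity of similitudes, right cancellation their surjectivity. If [h]
    has prefixes [f] and [f0], both send some point of [K] to the same point, so counting pieces
    that meet bounds the prefixes. *)
Lemma level_pressure : exists Pr C : R -> R,
  (forall q : R, 0 <= q -> forall n, `|ln (level_sum n q) - n%:R * Pr q| <= C q) /\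
  (forall q : R, 0 < q -> derivable Pr q 1).
Proof.
have [N0 HN0] := level_maps_near_count 0.
pose N := N0.+1.
have N1 : 1 <= N%:R :> R by rewrite ler1n.
have fibre n k h (s : seq (rV -> rV)) : h \in level_maps (n + k) -> uniq s ->
    {in s, forall f, f \in level_maps n /\ exists g,
      g \in level_maps k /\ f \o g = h} ->
    (size s <= N0)%N.
  move=> hG us Hs; have [f0 [g0 [f0G g0G e0]]] := level_factor hG.
  apply: (HN0 n f0) => // f /Hs[fG [g [gG e]]]; split => //.
  have [[x Kx] _ _] := KS.
  move/level_mapsP: g0G => [v0 _ v0E]; move/level_mapsP: gG => [v _ vE].
  exists (g0 x), (g x); split; [by rewrite v0E;
    apply: word_map_K KS _ _ Kx|by rewrite vE; apply: word_map_K KS _ _ Kx|].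
  have -> : f0 (g0 x) = f (g x) by rewrite -[LHS]/((f0 \o g0) x) e0 -e.
  by rewrite subrr enorm0 mul0r.
have GM n k x y : x \in G n -> y \in G k -> mul x y \in G (n + k)%N.
  move=> /GP[x1 x2] /GP[y1 y2]; apply/GP; split; rewrite /= ?x1 ?y1//.
  move: x2 y2 => /level_mapsP[u un ->] /level_mapsP[v vk ->].
  by apply/level_mapsP; exists (u ++ v); rewrite ?size_cat ?un ?vk// word_map_cat.
have PD := @pressure_differentiable R X mul G Y (ln N%:R) N.
have [||||||||||||Pr [H1 H2]] := PD; last first.
  exists Pr, (fun q => q * ln N%:R + ln N%:R); split => // q q0 n.
  by have := H1 q q0 n; rewrite /mass big_map.
- move=> n k h /GP[hn hG]; apply: (@leq_trans N0); last exact: leqnSn.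
  have us : uniq (prefixes mul G n k h).
    rewrite filter_uniq// map_inj_uniq ?undup_uniq//.
    by move=> f g e; exact: (congr1 snd e).
  have -> : size (prefixes mul G n k h) = size (map snd (prefixes mul G n k h)).
    by rewrite size_map.
  apply: (fibre n k h.2) => //.
    rewrite map_inj_in_uniq// => -[a f] [b g]; rewrite !mem_filter.
    by move=> /andP[_ /GP[/= -> _]] /andP[_ /GP[/= -> _]] ->.
  move=> f /mapP[x xP ->]; move: xP; rewrite mem_filter.
  move=> /andP[/hasP[y /GP[_ yG] /eqP e] /GP[_ xG]].
  by split => //; exists y.2; split => //; rewrite -e.
(* The heaviest of at most [N] factorisations carries at least [1 / N] of the weight of [h], whence
   the loss [ln N]. *)
- move=> n k [a h] /GP[/= -> hG].
  pose T := [seq fg : (rV -> rV) * (rV ->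
    rV) <- [seq (f, g) | f <- level_maps n, g <- level_maps k] | fg.1 \o fg.2 == h].
  have TE : map_weight (n + k) h =
    \sum_(y <- T) map_weight n y.1 * map_weight k y.2.
    rewrite map_weight_add big_filter [RHS]big_mkcond [RHS]sum_allpairs /=.
    by apply: eq_bigr => f _; rewrite [LHS]big_mkcond.
  have uT : uniq T.
    rewrite filter_uniq// allpairs_uniq ?undup_uniq//.
    by move=> [? ?] [? ?] _ _ [-> ->].
  have szT : (size T <= N0)%N.
    rewrite -(size_map fst); apply: (fibre n k h) => //.
      rewrite map_inj_in_uniq// => -[f g] [f' g']; rewrite !mem_filter /=.
      move=> /andP[/eqP e /allpairsP[[f0 g0] /= [f0G g0G [fE gE]]]].
      move=> /andP[/eqP e' _] ff'; subst; congr (_, _); apply/funext => x.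
      apply: (similitude_inj (level_maps_similitude f0G)).
      by have := congr1 (fun F => F x) e'.
    move=> f' /mapP[[f g] fgT ->] /=; move: fgT;
      rewrite mem_filter /= => /andP[/eqP e /allpairsP[[f0 g0]
      /= [f0G g0G [fE gE]]]].
    by subst; split => //; exists g0.
  have nT : T != [::].
    have [f [g [fG gG e]]] := level_factor hG.
    have : (f, g) \in T.
      by rewrite mem_filter /= e eqxx; apply/allpairsP; exists (f, g).
    by apply: contraTneq => ->.
  have [[f g] fgT PT] := sum_le_size_max (fun y =>
    map_weight n y.1 * map_weight k y.2) nT.
  move: (fgT); rewrite mem_filter /= =>
    /andP[/eqP e /allpairsP[[f0 g0] /= [f0G g0G [fE gE]]]].
  subst f0 g0; exists (n, f), (k, g); split.
  + exact/GP.
  + exact/GP.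
  + by rewrite /mul /= e.
  have Pf := map_weight_gt0 f0G; have Pg := map_weight_gt0 g0G.
  rewrite /Y /= -!lnM ?posrE ?mulr_gt0 ?ltr0n// ler_ln ?posrE ?mulr_gt0 ?ltr0n//;
    last first.
    exact: map_weight_gt0.
  rewrite TE (le_trans PT)// mulrC ler_wpM2l ?ler_nat ?mulr_ge0 ?ltW//.
  exact: leq_trans szT (leqnSn _).
- move=> n k f g /GP[f1 fG] /GP[g1 gG]; rewrite /Y /= f1 g1.
  have Pf := map_weight_gt0 fG; have Pg := map_weight_gt0 gG.
  rewrite -lnM ?posrE// ler_ln ?posrE ?mulr_gt0//; first exact: map_weight_mul.
  by apply: lt_le_trans (map_weight_mul fG gG); apply: mulr_gt0.
- by move=> n f /GP[f1 fG]; rewrite /Y ln_le0// map_weight_le1.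
- move=> n k [a f] [b f'] [e g] /GP[/= -> fG] /GP[/= -> f'G] /GP[/= -> gG] [ee].
  congr (_, _); apply/funext => y.
  have [x <-] := similitude_surj (level_maps_similitude gG) y.
  by have := congr1 (fun F => F x) ee.
- move=> n k [a f] [b g] [e g'] /GP[/= -> fG] /GP[/= -> gG] /GP[/= -> g'G] [ee].
  congr (_, _); apply/funext => x.
  apply: (similitude_inj (level_maps_similitude fG)).
  by have := congr1 (fun F => F x) ee.
- exact: GM.
- move=> n; have [[x0 Kx0] _ _] := KS.
  have [w wn _] := K_word KS n Kx0.
  by exists (n, word_map S w); apply/GP; split => //; apply: word_map_level.
- move=> n; rewrite map_inj_uniq ?undup_uniq//.
  by move=> f g e; exact: (congr1 snd e).
- by [].
- by rewrite ln_ge0.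
- by move=> [a f] [b g] [c h]; rewrite /mul /= addnA.
Qed.

End LevelMaps.

(** * The self-similar measure and packings *)

Section Measure.
Variables (R : realType) (d m : nat).
Notation rV := 'rV[R]_d.
Variables (S : 'I_m -> rV -> rV) (K : set rV) (rho : R) (p : 'I_m -> R).
Variable mu : probability (borel_rV R d) R.
Hypothesis simS : forall i, similitude rho (S i).
Hypothesis rho0 : 0 < rho.
Hypothesis rho1 : rho < 1.
Hypothesis KS : self_similar_set S K.
Hypothesis ftcS : finite_type_condition S K.
Hypothesis probp : probability_vector p.
Hypothesis muS : self_similar_measure S p mu.

Definition rmass (A : set rV) : R := fine (mu A).

Lemma closed_borel (A : set rV) : closed A -> measurable (A : set (borel_rV R d)).
Proof.
move=> cA; rewrite -(setCK A); apply: measurableC.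
by apply: sub_sigma_algebra; apply: closed_openC.
Qed.

Lemma rmassE (A : set rV) : closed A -> mu A = (rmass A)%:E.
Proof. by move=> /closed_borel mA; rewrite fineK// fin_num_measure. Qed.

Lemma rmass_ge0 A : 0 <= rmass A.
Proof. by rewrite fine_ge0. Qed.

Lemma rmass_le A B : closed A -> closed B -> A `<=` B -> rmass A <= rmass B.
Proof.
move=> cA cB AB; rewrite -lee_fin -!rmassE//.
by apply: le_measure => //; rewrite inE; apply: closed_borel.
Qed.

Lemma rmass_le1 A : closed A -> rmass A <= 1.
Proof. by move=> cA; rewrite -lee_fin -rmassE// probability_le1//;
  apply: closed_borel. Qed.

Lemma preimage_level n f A : f \in level_maps S n -> closed A -> closed (f @^-1` A).
Proof.
move=> fn cA; apply: closed_comp => // x _.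
exact: (similitude_continuous (level_maps_similitude simS fn)).
Qed.

Lemma word_preimage w A : closed A -> closed (word_map S w @^-1` A).
Proof.
move=> cA; apply: closed_comp => // x _.
exact: (similitude_continuous (word_map_similitude simS w)).
Qed.

Lemma rmass_words n A : closed A ->
  rmass A = \sum_(w <- words m n) weight p w * rmass (word_map S w @^-1` A).
Proof.
elim: n A => [|n IH] A cA.
  by rewrite big_seq1 /weight big_nil mul1r.
have cS i : closed (S i @^-1` A) := @word_preimage [:: i] A cA.
rewrite [RHS]big_allpairs_dep /= big_enum /=.
apply: EFin_inj; rewrite -rmassE// muS; last exact: closed_borel.
rewrite -sumEFin; apply: eq_bigr => i _.
rewrite rmassE// -EFinM IH// mulr_sumr; congr (_%:E); apply: eq_bigr => w _.
by rewrite /weight big_cons mulrA.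
Qed.

Lemma rmass_level n A : closed A -> rmass A =
  \sum_(f <- level_maps S n) map_weight S p n f * rmass (f @^-1` A).
Proof.
move=> cA; rewrite (rmass_words n cA).
rewrite (@sum_fibers _ _ _ (level_maps S n) _ (word_map S)) ?undup_uniq//;
  last first.
  by move=> u; apply: word_map_level.
apply: eq_bigr => f _; rewrite /map_weight mulr_suml.
by apply: eq_bigr => w /= /eqP ->.
Qed.

Variable x0 : rV.
Hypothesis Kx0 : K x0.

(** Maps of level [n] send the ball of radius [s] about [x0] into that of radius [s * rho ^+ n + D],
    so by self-similarity the latter has at least as much mass. Letting [s] grow, with [n] depending
    on [s], puts all mass within [1 + D]. Images of this ball then stand for the pieces of [mu]. *)
Lemma full_ball : exists2 r, 0 < r & rmass (cball x0 r) = 1.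
Proof.
have [D D0 HD] := K_bounded KS.
have step n s : rmass (cball x0 s) <= rmass (cball x0 (s * rho ^+ n + D)).
  rewrite (rmass_words n (@closed_cball _ _ x0 (s * rho ^+ n + D))).
  rewrite -[leLHS]mul1r -(sum_words_prod n probp.2) mulr_suml.
  rewrite big_seq [leRHS]big_seq; apply: ler_sum => w.
  rewrite mem_words => /eqP wn.
  apply: ler_wpM2l; first exact: ltW (weight_gt0 probp w).
  apply: rmass_le; [exact: closed_cball|by apply: word_preimage;
    apply: closed_cball|].
  move=> y ys; rewrite /preimage /cball /=.
  apply: (le_trans (enorm_triangle (word_map S w x0) _ _)); apply: lerD.
    rewrite (word_map_similitude simS w).2 wn [leRHS]mulrC.
    by apply: ler_wpM2l => //; rewrite exprn_ge0// ltW.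
  by apply: HD => //; apply: word_map_K KS _ _ Kx0.
exists (1 + D); first by rewrite addr_gt0.
have cb r : closed (cball x0 r) := @closed_cball _ _ x0 r.
apply: le_anti; rewrite rmass_le1//= -lee_fin -rmassE// -(probability_setT mu).
pose F (n : nat) : set (borel_rV R d) := cball x0 n%:R.
have mF i : measurable (F i) := closed_borel (cb i%:R).
have FT : \bigcup_n F n = setT.
  apply/seteqP; split => // y _; exists (Num.bound (enorm (y - x0))) => //.
  by rewrite /F /cball /= ltW// archi_boundP// enorm_ge0.
have ndF : nondecreasing_seq F.
  move=> i j ij; apply/subsetPset => y; rewrite /F /cball /= => h.
  by rewrite (le_trans h)// ler_nat.
have cF : mu \o F @ \oo --> mu (\bigcup_n F n).
  by apply: nondecreasing_cvg_mu => //; rewrite FT; apply: measurableT.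
rewrite -FT; apply: cvge_le cF; near=> k.
have [n hn] : exists n, k%:R * rho ^+ n <= 1.
  by apply: exists_expr_le => //; rewrite rho0.
rewrite /= /F rmassE// rmassE// lee_fin (le_trans (step n _))//.
apply: rmass_le => // y; rewrite /cball /= => h.
by rewrite (le_trans h)// lerD2r.
Unshelve. all: by end_near. Qed.

Section Balls.
Variable r : R.
Hypothesis r0 : 0 < r.
Hypothesis full : rmass (cball x0 r) = 1.

Lemma rmass_disjoint A : closed A -> (forall y, cball x0 r y -> ~ A y) ->
  rmass A = 0.
Proof.
move=> cA dA; have cb := @closed_cball _ _ x0 r.
have mA := closed_borel cA; have mb := closed_borel cb.
have : mu ((A : set (borel_rV R d)) `|` cball x0 r) = (mu A + mu (cball x0 r))%E.
  apply: measureU => //; apply/seteqP; split => // y [Ay yb].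
  exact: dA yb Ay.
have : (mu ((A : set (borel_rV R d)) `|` cball x0 r) <= 1)%E.
  by apply: probability_le1; apply: measurableU.
move=> h e; move: h; rewrite e !rmassE// full -EFinD lee_fin => h.
by apply: le_anti; rewrite rmass_ge0 andbT; lra.
Qed.

Lemma rmass_superset A : closed A -> cball x0 r `<=` A -> rmass A = 1.
Proof.
move=> cA sA; apply: le_anti; rewrite rmass_le1//= -full.
by apply: rmass_le => //; apply: closed_cball.
Qed.

Lemma level_cball n f (delta : R) : f \in level_maps S n -> r * rho ^+ n <= delta ->
  map_weight S p n f <= rmass (cball (f x0) delta).
Proof.
move=> fn rd; have cb := @closed_cball _ _ (f x0) delta.
rewrite (rmass_level n cb) (perm_big _ (perm_to_rem fn)) big_cons /=.
rewrite rmass_superset; first last.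
- move=> y yb; rewrite /preimage /cball /= (level_maps_similitude simS fn).2.
  by rewrite (le_trans _ rd)// [leRHS]mulrC ler_wpM2l// exprn_ge0// ltW.
- exact: preimage_level fn cb.
rewrite mulr1 ler_wpDr//; apply: sumr_ge0 => g _.
by rewrite mulr_ge0 ?rmass_ge0// map_weight_ge0.
Qed.

(** [f x0] lies in images of [K] of arbitrarily high level; the image of the full ball under such a
    map is small, close to [f x0], and has at least the positive weight of the map. *)
Lemma level_map_supp n f : f \in level_maps S n -> supp mu (f x0).
Proof.
move=> fn U oU Ufx.
have [e e0 He] : exists2 e : R, 0 < e & cball (f x0) e `<=` U.
  have [e /= e0 He] := (@nbhs_normP R rV (f x0) U).1 (open_nbhs_nbhs (conj oU Ufx)).
  exists (e / 2); first exact: divr_gt0.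
  move=> y; rewrite /cball /= => h; apply: He => /=.
  by rewrite (le_lt_trans (norm_le_enorm _))// enormB (le_lt_trans h)// gtr_pMr//
    invf_lt1// ltr1n.
have [D D0 HD] := K_bounded KS.
have [j hj] : exists j, (r + D) * rho ^+ j <= e.
  by apply: exists_expr_le => //; rewrite rho0.
have /level_mapsP[w wn fE] := fn.
have [v vj [y Ky yx]] := K_word KS j Kx0.
pose g := word_map S (w ++ v).
have gn : g \in level_maps S (n + j)%N.
  by apply: word_map_level; rewrite mem_words size_cat wn -(eqP (_ : size v ==
    j)) -?mem_words.
have cbe := @closed_cball _ _ (f x0) e.
have lt0 : 0 < rmass (cball (f x0) e).
  apply: (lt_le_trans (map_weight_gt0 probp gn)).
  apply: (le_trans (level_cball gn (lexx _))).
  apply: rmass_le => //; first exact: closed_cball.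
  move=> z; rewrite /cball /= => h.
  apply: (le_trans (enorm_triangle (g x0) _ _)); apply: le_trans hj.
  have -> : f x0 = g y by rewrite /g word_map_cat fE /= yx.
  rewrite (level_maps_similitude simS gn).2.
  have rj : rho ^+ (n + j) <= rho ^+ j by rewrite ler_wiXn2l ?leq_addl// ltW.
  have := HD x0 y Kx0 Ky; have := exprn_gt0 (n + j) rho0 => rp hD.
  apply: (@le_trans _ _ ((r + D) * rho ^+ (n + j))).
    by rewrite mulrDl lerD// [leRHS]mulrC ler_wpM2l// ltW.
  by rewrite ler_wpM2l// addr_ge0// ltW.
apply: (@lt_le_trans _ _ (mu (cball (f x0) e))); first by rewrite rmassE// lte_fin.
apply: le_measure; rewrite ?inE//; first exact: closed_borel.
exact: sub_sigma_algebra.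
Qed.

Lemma cball_level n x (delta : R) : 0 < rmass (cball x delta) ->
  exists2 f, f \in level_maps S n & enorm (f x0 - x) <= delta + r * rho ^+ n.
Proof.
have cb := @closed_cball _ _ x delta; rewrite (rmass_level n cb) => h.
have [f fn fp] : exists2 f, f \in level_maps S n & 0 < rmass (f @^-1` cball x
  delta).
  apply: contrapT => no; move: h; rewrite big_seq big1 ?ltxx// => f fn.
  apply/eqP; rewrite mulf_eq0; apply/orP; right.
  by rewrite eq_le rmass_ge0 andbT leNgt; apply/negP => fp; apply: no; exists f.
exists f => //.
have [y yb yx] : exists2 y, cball x0 r y & cball x delta (f y).
  apply: contrapT => no; move: fp; rewrite rmass_disjoint ?ltxx//.
    exact: preimage_level fn cb.
  by move=> y yb yx; apply: no; exists y.
apply: (le_trans (enorm_triangle (f y) _ _)); rewrite addrC lerD//.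
rewrite (level_maps_similitude simS fn).2 [leRHS]mulrC enormB.
by apply: ler_wpM2l => //; rewrite exprn_ge0// ltW.
Qed.

Lemma rmass_cball_le n x (delta : R) : rmass (cball x delta) <=
  \sum_(f <- level_maps S n | enorm (f x0 - x) <=
    delta + r * rho ^+ n) map_weight S p n f.
Proof.
have cb := @closed_cball _ _ x delta; rewrite (rmass_level n cb).
rewrite [leRHS]big_mkcond big_seq [leRHS]big_seq; apply: ler_sum => f fn.
case: ifPn => [_|nf].
  by rewrite ler_piMr ?map_weight_ge0// rmass_le1//; apply: preimage_level fn cb.
rewrite rmass_disjoint ?mulr0//; first exact: preimage_level fn cb.
move=> y yb yx; move/negP: nf; apply.
apply: (le_trans (enorm_triangle (f y) _ _)); rewrite addrC lerD//.
rewrite (level_maps_similitude simS fn).2 [leRHS]mulrC enormB.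
by apply: ler_wpM2l => //; rewrite exprn_ge0// ltW.
Qed.

End Balls.
End Measure.

Section IndependentSet.
Variables (R : realType) (T : eqType) (e : rel T) (w : T -> R) (N : nat).
Hypothesis e_sym : symmetric e.
Hypothesis w_ge0 : forall x, 0 <= w x.

(* Greedy choice: keep a heaviest vertex, discard its neighbours. *)
Lemma heavy_independent_set (s : seq T) : uniq s -> {in s, reflexive e} ->
  {in s, forall x, (count (e x) s <= N)%N} ->
  exists I, [/\ uniq I, {subset I <= s}, {in I &, forall x y, e x y -> x = y} &
    \sum_(x <- s) w x <= N%:R * \sum_(x <- I) w x].
Proof.
have [n] := ubnP (size s); elim: n s => // n IH s; rewrite ltnS => sn us er eN.
have [->|s0] := eqVneq s [::].
  by exists [::]; split => //; rewrite !big_nil mulr0.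
have [f fs fmax] : exists2 f, f \in s & {in s, forall g, w g <= w f}.
  elim: s s0 {sn us er eN} => // x [|y s] IHs _.
    by exists x; rewrite ?mem_head// => g; rewrite inE => /eqP ->.
  have [//|f fs fmax] := IHs.
  have [xf|fx] := leP (w x) (w f).
    exists f; first by rewrite inE fs orbT.
    by move=> g; rewrite inE => /orP[/eqP ->//|/fmax].
  exists x; first exact: mem_head.
  move=> g; rewrite inE => /orP[/eqP ->//|/fmax gf].
  by rewrite (le_trans gf)// ltW.
pose s' := [seq g <- s | ~~ e f g].
have s's : {subset s' <= s} by move=> x; rewrite mem_filter => /andP[].
have [||||I [uI Is' Ii Iw]] := IH s'.
- rewrite (leq_trans _ sn)// size_filter -(count_predC (e f) s)
  -addn1 addnC leq_add//.
  by rewrite -has_count; apply/hasP; exists f; rewrite ?er.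
- exact: filter_uniq.
- by move=> x /s's xs; apply: er.
- move=> x /s's xs; rewrite (leq_trans _ (eN _ xs))// count_filter.
  by apply: sub_count => y /= /andP[].
have fI g : g \in I -> ~~ e f g by move=> /Is'; rewrite mem_filter => /andP[].
exists (f :: I); split => /=.
- by rewrite uI andbT; apply/negP => /fI; rewrite er.
- by move=> x; rewrite inE => /orP[/eqP ->//|/Is'/s's].
- move=> x y; rewrite !inE => /orP[/eqP ->|xI] /orP[/eqP ->|yI] //.
  + by move=> exy; have := fI _ yI; rewrite exy.
  + by rewrite e_sym => exy; have := fI _ xI; rewrite exy.
  + exact: Ii.
rewrite big_cons mulrDr (bigID (e f))/= lerD//; last by rewrite -big_filter.
apply: (@le_trans _ _ (\sum_(x <- s | e f x) w f)).
  by rewrite big_seq_cond [leRHS]big_seq_cond; apply: ler_sum => x /andP[/fmax].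
rewrite big_const_seq iter_addr_0 -[leLHS]mulr_natl ler_wpM2r// ler_nat.
exact: eN.
Qed.

End IndependentSet.

(** * Packing sums against level sums *)

Section Packing.
Variables (R : realType) (d m : nat).
Notation rV := 'rV[R]_d.
Variables (S : 'I_m -> rV -> rV) (K : set rV) (rho : R) (p : 'I_m -> R).
Variable mu : probability (borel_rV R d) R.
Hypothesis simS : forall i, similitude rho (S i).
Hypothesis rho0 : 0 < rho.
Hypothesis rho1 : rho < 1.
Hypothesis KS : self_similar_set S K.
Hypothesis ftcS : finite_type_condition S K.
Hypothesis probp : probability_vector p.
Hypothesis muS : self_similar_measure S p mu.
Variables (x0 : rV) (r : R).
Hypothesis Kx0 : K x0.
Hypothesis r0 : 0 < r.
Hypothesis full : rmass mu (cball x0 r) = 1.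

Local Notation W n f := (map_weight S p n f).
Local Notation lev n := (level_maps S n).

Lemma close_count (L : R) : exists2 N : nat,
  (0 < N)%N & forall n f (s : seq (rV -> rV)),
  f \in lev n -> uniq s ->
  {in s, forall g, g \in lev n /\ enorm (f x0 - g x0) <= L * rho ^+ n} ->
    (size s <= N)%N.
Proof.
have [N H] := level_maps_near_count simS rho0 rho1 KS ftcS L.
exists N.+1 => // n f s fn us Hs; rewrite (leq_trans _ (leqnSn _))//.
apply: (H n f) => // g /Hs[gn fg]; split => //.
by exists x0, x0.
Qed.

Lemma powR_map_weight n f q : f \in lev n -> W n f `^ q = expR (q * ln (W n f)).
Proof. by move=> fn; rewrite /powR gt_eqF// map_weight_gt0. Qed.

Lemma poweR_cball x delta q : (mu (cball x delta) `^ q)%E =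
  (rmass mu (cball x delta) `^ q)%:E.
Proof. by rewrite -poweR_EFin -rmassE//; apply: closed_cball. Qed.

(** Two counts give the two factors of the constant. At most [N] maps are near a ball, so its mass
    is at most [N] times the heaviest of their weights; and a map is near at most [N] centres, as
    disjoint balls have distinct nearby maps [g x]. *)
Lemma packing_sup_le q : 0 < q -> exists2 C : R, 0 < C & forall n delta,
  2 * r * rho ^+ n <= delta -> delta * rho <= 2 * r * rho ^+ n ->
  (packing_sup mu q delta <= (C * level_sum S p n q)%:E)%E.
Proof.
move=> q0; pose L := 4 * r / rho + r.
have [N N0 HN] := close_count L.
have N0' : 0 < N%:R :> R by rewrite ltr0n.
exists (N%:R * N%:R `^ q); first by rewrite mulr_gt0// powR_gt0.
move=> n delta h1 h2.
have rn : 0 < rho ^+ n by apply: exprn_gt0.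
have rrn : 0 < r * rho ^+ n by apply: mulr_gt0.
have d0 : 0 < delta by rewrite (lt_le_trans _ h1)// -mulrA mulr_gt0.
have dL : 2 * delta + r * rho ^+ n <= L * rho ^+ n.
  rewrite /L [leRHS]mulrDl lerD2r mulrAC ler_pdivlMr// -mulrA.
  have -> : 4 * r * rho ^+ n = 2 * (2 * r * rho ^+ n) by ring.
  by rewrite ler_pM2l.
apply: ge_ereal_sup => _ [C [Csupp Ctriv] <-].
apply: ge_ereal_sup => _ [A [finA AC] <-].
rewrite fsbig_finite//=; under eq_bigr do rewrite poweR_cball.
rewrite sumEFin lee_fin.
set xs : seq rV := finmap.enum_fset (fset_set A).
have xsA x : x \in xs -> A x by rewrite in_fset_set// inE.
have uxs : uniq xs by apply: finmap.fset_uniq.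
pose Near x := [seq f <- lev n | enorm (f x0 - x) <= delta + r * rho ^+ n].
have /choice[g Hg] : forall x, exists g, x \in xs ->
  g \in lev n /\ enorm (g x0 - x) <= delta.
  move=> x; have [xxs|_] := boolP (x \in xs); last by exists id.
  have xs' := Csupp _ (AC _ (xsA _ xxs)).
  (* Half the radius leaves room for [r * rho ^+ n <= delta / 2]: the point [g x x0] then lies in
     the ball itself, and disjointness makes [g] injective on the centres. *)
  have pos : 0 < rmass mu (cball x (delta / 2)).
    pose B := [set y : rV | enorm (y - x) < delta / 2].
    have oB : open B.
      have -> : B = ~` [set y | delta / 2 <= enorm (y - x)].
        by apply/seteqP; split => y; rewrite /B /= ltNge => /negP.
      apply: closed_openC; apply: (@closed_comp _ _ (fun y : rV =>
        enorm (y - x)) [set t | delta / 2 <= t]).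
        move=> y _; apply: continuous_comp; last exact: continuous_enorm.
        apply: (@continuous_of_elipschitz _ _ (fun y => y - x) 1) => // u v.
        by rewrite mul1r opprB addrA subrK.
      exact: closed_ge.
    have := xs' B oB; rewrite /B /= subrr enorm0 divr_gt0// => /(_ isT) B0.
    rewrite -lte_fin -rmassE; last exact: closed_cball.
    apply: (lt_le_trans B0); apply: le_measure; rewrite ?inE.
    - exact: sub_sigma_algebra.
    - by apply: closed_borel; apply: closed_cball.
    - by move=> y /= /ltW.
  have [f fn fx] := cball_level simS rho0 muS full n pos.
  exists f => _; split => //; apply: (le_trans fx); lra.
have near_g x f : x \in xs -> f \in Near x -> enorm (g x x0 - f x0) <= L * rho ^+ n.
  move=> /Hg[gn gx]; rewrite mem_filter => /andP[fx _].
  apply: (le_trans (enorm_triangle x _ _)); rewrite (enormB x).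
  by apply: le_trans dL; move: fx gx; lra.
have step x : x \in xs -> rmass mu (cball x delta) `^ q <=
    N%:R `^ q * \sum_(f <- Near x) expR (q * ln (W n f)).
  move=> xxs.
  have := rmass_cball_le simS rho0 probp muS full n x delta.
  rewrite -big_filter -/(Near x) => hx.
  have szN : (size (Near x) <= N)%N.
    apply: (HN n (g x)); [exact: (Hg x xxs).1|by rewrite filter_uniq// undup_uniq|].
    by move=> f fN; split; [move: fN; rewrite mem_filter => /andP[]|exact: near_g].
  have [Nx0|Nx] := eqVneq (Near x) [::].
    move: hx; rewrite Nx0 !big_nil mulr0 => hx.
    have -> : rmass mu (cball x delta) = 0.
      by apply: le_anti; rewrite hx rmass_ge0.
    by rewrite powR0// gt_eqF.
  have [f fN fmax] := sum_le_size_max (fun f => W n f) Nx.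
  have fn : f \in lev n by move: fN; rewrite mem_filter => /andP[].
  have hle : rmass mu (cball x delta) <= N%:R * W n f.
    rewrite (le_trans hx)// (le_trans fmax)// ler_wpM2r ?ler_nat//.
    exact: map_weight_ge0.
  apply: (le_trans (ge0_ler_powR (ltW q0) _ _ hle)); rewrite ?nnegrE ?rmass_ge0//.
    by rewrite mulr_ge0// map_weight_ge0.
  rewrite powRM ?map_weight_ge0// (powR_map_weight _ fn).
  apply: ler_wpM2l; first exact: powR_ge0.
  rewrite (perm_big _ (perm_to_rem fN)) big_cons lerDl; apply: sumr_ge0 => ? _.
  exact: expR_ge0.
rewrite big_seq; apply: (le_trans (ler_sum _ step)); rewrite -big_seq -mulr_sumr.
rewrite [N%:R * _]mulrC -mulrA ler_wpM2l ?powR_ge0//.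
rewrite /level_sum mulr_sumr.
under eq_bigr do rewrite big_filter.
rewrite (exchange_big_dep predT)//= big_seq [leRHS]big_seq; apply: ler_sum => f fn.
rewrite big_const_seq iter_addr_0 -[leLHS]mulr_natl ler_wpM2r ?expR_ge0// ler_nat.
rewrite -size_filter -(size_map g). set ys := [seq x <- xs | _].
have ysxs : {subset ys <= xs} by move=> y; rewrite mem_filter => /andP[].
apply: (HN n f) => //.
  rewrite map_inj_in_uniq ?filter_uniq// => y z /ysxs yxs /ysxs zxs gyz.
  apply: Ctriv; [exact: AC (xsA _ yxs)|exact: AC (xsA _ zxs)|].
  exists (g y x0); split; rewrite /cball /=; first exact: (Hg _ yxs).2.
  by rewrite gyz; exact: (Hg _ zxs).2.
move=> _ /mapP[y yys ->]; split; first exact: (Hg _ (ysxs _ yys)).1.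
rewrite enormB; apply: near_g (ysxs _ yys) _.
by move: yys; rewrite !mem_filter fn => /andP[->].
Qed.

(** The points [f x0] lie in the support but their balls may overlap. An independent set for the
    overlap relation, whose degree is at most [N], is a packing that keeps the share [1 / N] of the
    level sum. *)
Lemma packing_sup_ge q : 0 < q -> exists2 c : R, 0 < c & forall n delta,
  2 * r * rho ^+ n <= delta -> delta * rho <= 2 * r * rho ^+ n ->
  ((c * level_sum S p n q)%:E <= packing_sup mu q delta)%E.
Proof.
move=> q0; have [N N0 HN] := close_count (4 * r / rho).
have N0' : 0 < N%:R :> R by rewrite ltr0n.
exists (N%:R^-1); first by rewrite invr_gt0.
move=> n delta h1 h2.
have rn : 0 < rho ^+ n by apply: exprn_gt0.
have rrn : 0 < r * rho ^+ n by apply: mulr_gt0.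
have d0 : 0 < delta by rewrite (lt_le_trans _ h1)// -mulrA mulr_gt0.
have rd : r * rho ^+ n <= delta by rewrite (le_trans _ h1)// -mulrA ler_peMl
  ?ltW// ltr1n.
have dL : 2 * delta <= 4 * r / rho * rho ^+ n.
  rewrite mulrAC ler_pdivlMr// -mulrA.
  have -> : 4 * r * rho ^+ n = 2 * (2 * r * rho ^+ n) by ring.
  by rewrite ler_pM2l.
pose e (f g : rV -> rV) := `[< (cball (f x0) delta `&` cball (g x0) delta)
  !=set0 >].
have esym : symmetric e by move=> f g; rewrite /e setIC.
have erefl f : e f f.
  by apply/asboolP; exists (f x0); split; rewrite /cball /= subrr enorm0 ltW.
have eclose f g : e f g -> enorm (f x0 - g x0) <= 2 * delta.
  move=> /asboolP[y [fy gy]]; apply: (le_trans (enorm_triangle y _ _)).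
  by move: fy gy; rewrite /cball /= (enormB (f x0)); lra.
pose w f := expR (q * ln (W n f)).
have [||||I [uI Isub Iind Iw]] := @heavy_independent_set R _ e w N esym _ (lev n).
- by move=> f; apply: expR_ge0.
- exact: undup_uniq.
- by move=> f _; apply: erefl.
- move=> f fn; rewrite -size_filter; apply: (HN n f) => //.
    by rewrite filter_uniq// undup_uniq.
  by move=> g; rewrite mem_filter => /andP[/eclose fg gn]; split => //;
    apply: (le_trans fg).
pose xs := [seq f x0 | f <- I].
have uxs : uniq xs.
  rewrite map_inj_in_uniq// => f g fI gI fg; apply: Iind => //.
  by rewrite /e fg; apply/asboolP; exists (g x0); split;
    rewrite /cball /= subrr enorm0 ltW.
apply: (@le_trans _ _ (\esum_(x in [set` xs]) (mu (cball x delta) `^ q))%E);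
  last first.
  apply: ereal_sup_ubound; exists [set` xs] => //; split.
    move=> _ /= /mapP[f fI ->]; apply: (level_map_supp simS rho0 rho1 KS probp muS
      Kx0 r0 full).
    exact: Isub fI.
  move=> _ _ /= /mapP[f fI ->] /mapP[g gI ->] fg.
  by congr (_ x0); apply: Iind => //; apply/asboolP.
rewrite esum_fset; [|exact: finite_seq|by move=> *; apply: poweR_ge0].
rewrite -fsbig_seq// big_map; under eq_bigr do rewrite poweR_cball.
rewrite sumEFin lee_fin ler_pdivrMl//; apply: (le_trans Iw).
rewrite ler_wpM2l// big_seq [leRHS]big_seq; apply: ler_sum => f /Isub fn.
rewrite /w -(powR_map_weight _ fn)
  ge0_ler_powR ?nnegrE ?rmass_ge0 ?map_weight_ge0 ?(ltW q0)//.
exact: (level_cball simS rho0 probp muS full fn rd).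
Qed.

End Packing.

(** * From packing sums to the spectrum *)

Section Spectrum.
Variable R : realType.

Lemma limf_einf_squeeze (f : R -> \bar R) (F : set_system R) (v : R) :
  ProperFilter F ->
  (forall e : R, 0 < e -> \forall x \near F,
    (((v - e)%:E <= f x) && (f x <= (v + e)%:E))%E) ->
  limf_einf f F = v%:E.
Proof.
move=> FF H; rewrite limf_einfE; apply/le_anti/andP; split.
  apply/lee_addgt0Pr => e e0; apply: ge_ereal_sup => _ [V FV <-].
  have [x [Vx /andP[_ fx]]] := filter_ex (filterI FV (H e e0)).
  by apply: le_trans fx; apply: ereal_inf_lbound; exists x.
apply/lee_subgt0Pr => e e0.
apply: (@le_trans _ _ (ereal_inf (f @` [set x | (((v - e)%:E <= f x) && (f x <=
  (v + e)%:E))%E]))).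
  by apply: le_ereal_inf_tmp => _ [x /= /andP[fx _] <-].
by apply: ereal_sup_ubound; eexists; [exact: H e e0|].
Qed.

Lemma scale_exists (rho s delta : R) : 0 < rho < 1 -> 0 < delta <= s -> exists n,
  s * rho ^+ n <= delta /\ delta * rho <= s * rho ^+ n.
Proof.
move=> /[dup] rho01 /andP[rho0 rho1] /andP[d0 ds].
have ex := exists_expr_le s rho01 d0.
case: (ex_minnP ex) => n hn nmin; exists n; split => //.
case: n hn nmin => [|n] hn nmin.
  by rewrite expr0 mulr1 (le_trans _ ds)// ler_piMr ?ltW.
rewrite exprS mulrCA mulrC ler_pM2l// leNgt; apply/negP => h.
by have := nmin n (ltW h); rewrite ltnn.
Qed.

(** The terms in [n] cancel in [a * lr - P * b], which is therefore bounded; a large [- b] makes the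
    error small whatever [n] is. *)
Lemma ratio_close (a b P lr C D e : R) (n : nat) : lr < 0 -> b < 0 -> 0 < e ->
  `|a - n%:R * P| <= C -> `|b - n%:R * lr| <= D ->
  (C * `|lr| + `|P| * D) / (e * `|lr|) <= - b ->
  P / lr - e <= a * b^-1 <= P / lr + e.
Proof.
move=> lr0 b0 e0 ha hb; rewrite ler_pdivrMr ?mulr_gt0 ?normr_gt0 ?lt_eqF// => h.
rewrite -ler_distl.
have -> : a * b^-1 - P / lr = ((a - n%:R * P) * lr - P * (b - n%:R * lr))
  / (b * lr).
  by field; rewrite !lt_eqF.
have bl : 0 < b * lr by rewrite nmulr_lgt0.
rewrite normrM normfV (gtr0_norm bl) ler_pdivrMr//.
apply: (le_trans (ler_normB _ _)); rewrite !normrM.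
have h1 : `|a - n%:R * P| * `|lr| <= C * `|lr| by rewrite ler_wpM2r.
have h2 : `|P| * `|b - n%:R * lr| <= `|P| * D by rewrite ler_wpM2l.
have -> : e * (b * lr) = - b * (e * `|lr|) by rewrite (ltr0_norm lr0); ring.
by lra.
Qed.

End Spectrum.

Lemma Lq_spectrum_level (R : realType) (d m : nat) (S : 'I_m -> 'rV[R]_d ->
  'rV[R]_d)
    (K : set 'rV[R]_d) (rho : R) (p : 'I_m -> R) (mu : probability (borel_rV R d) R)
    (q P C : R) :
  (forall i, similitude rho (S i)) -> 0 < rho < 1 -> self_similar_set S K ->
  finite_type_condition S K -> probability_vector p ->
    self_similar_measure S p mu ->
  0 < q -> (forall n, `|ln (level_sum S p n q) - n%:R * P| <= C) ->
  Lq_spectrum mu q = (P / ln rho)%:E.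
Proof.
move=> simS /[dup] rho01 /andP[rho0 rho1] KS ftcS probp muS q0 HP.
have [[x0 Kx0] _ _] := KS.
have [r r0 full] := full_ball simS rho0 rho1 KS probp muS Kx0.
have [C1 C10 up] := packing_sup_le simS rho0 rho1 KS ftcS probp muS Kx0 r0 full q0.
have [C2 C20 low] := packing_sup_ge simS rho0 rho1 KS ftcS probp muS Kx0 r0 full q0.
have lr0 : ln rho < 0 by rewrite ln_lt0// rho0.
have r20 : 0 < 2 * r by rewrite mulr_gt0.
pose A := C + `|ln C1| + `|ln C2|.
pose D := `|ln (2 * r)| + `|ln rho|.
apply: limf_einf_squeeze => e e0.
pose B := (A * `|ln rho| + `|P| * D) / (e * `|ln rho|).
(* [2 * r] ensures a level of the size of [delta], [expR (- B)] makes [- ln delta] large enough for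
   the error [e], and 1/2 keeps [ln delta] negative. *)
pose t := Num.min (2 * r) (Num.min (expR (- B)) 2^-1).
have t0 : 0 < t by rewrite !lt_min r20 expR_gt0 /= invr_gt0.
near=> delta.
have d0 : 0 < delta by near: delta; exact: nbhs_right_gt.
have : delta < t by near: delta; exact: nbhs_right_lt.
rewrite !lt_min => /and3P[d1 d2 d3].
have [|n [h1 h2]] := @scale_exists R rho (2 * r) delta rho01;
  first by rewrite d0 ltW.
have Z0 : 0 < level_sum S p n q.
  have [w wn _] := K_word KS n Kx0; have fn := word_map_level S wn.
  rewrite /level_sum (perm_big _ (perm_to_rem fn)) big_cons ltr_pwDl ?expR_gt0//.
  by apply: sumr_ge0 => ? _; apply: expR_ge0.
have := up _ _ h1 h2; have := low _ _ h1 h2.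
case E : (packing_sup mu q delta) => [x| |] //; rewrite !lee_fin => x1 x2.
have x0' : 0 < x by rewrite (lt_le_trans _ x1)// mulr_gt0.
rewrite lne_EFin// -EFinM !lee_fin.
have l1 : ln x <= ln C1 + ln (level_sum S p n q).
  by rewrite -lnM ?posrE// ler_ln ?posrE ?mulr_gt0.
have l2 : ln C2 + ln (level_sum S p n q) <= ln x.
  by rewrite -lnM ?posrE// ler_ln ?posrE ?mulr_gt0.
have rn0 : 0 < rho ^+ n by rewrite exprn_gt0.
have l3 : ln (2 * r) + n%:R * ln rho <= ln delta.
  by rewrite [n%:R * ln rho]mulr_natl -lnXn// -lnM ?posrE// ler_ln ?posrE ?mulr_gt0.
have l4 : ln delta + ln rho <= ln (2 * r) + n%:R * ln rho.
  by rewrite [n%:R * ln rho]mulr_natl -lnXn// -!lnM ?posrE// ler_ln ?posrE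
    ?mulr_gt0.
have d1' : delta < 1 by rewrite (lt_trans d3)// invf_lt1// ltr1n.
apply: (@ratio_close R (ln x) (ln delta) P (ln rho) A D e n) => //.
- by rewrite ln_lt0// d0.
- have := HP n; rewrite !ler_norml /A.
  have := ler_norm (ln C1); have := ler_norm (- ln C2); rewrite normrN.
  have := normr_ge0 (ln C1); have := normr_ge0 (ln C2).
  by move=> ? ? ? ? /andP[? ?]; apply/andP; split; lra.
- rewrite !ler_norml /D.
  have := ler_norm (- ln (2 * r)); have := ler_norm (ln (2 * r)); rewrite normrN.
  have := ler_norm (- ln rho); rewrite normrN; have := normr_ge0 (ln rho).
  by move=> ? ? ? ?; apply/andP; split; lra.
rewrite -/B lerNr -ler_expR lnK ?posrE//; exact: ltW.
Unshelve. all: by end_near. Qed.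

Unset Implicit Arguments.

Theorem theorem1p3 (R : realType) (d m : nat) (d_gt0 : (0 < d)%N)
    (S : 'I_m -> 'rV[R]_d -> 'rV[R]_d) (K : set 'rV[R]_d)
    (p : 'I_m -> R) (mu : probability (borel_rV R d) R)
    (ifsS : is_ifs S) (equiS : equicontractive S)
    (KS : self_similar_set S K) (ftcS : finite_type_condition S K)
    (probp : probability_vector p) (muS : self_similar_measure S p mu) :
  forall q : R, 0 < q ->
    Lq_spectrum mu q \is a fin_num /\
    derivable (fun s : R => fine (Lq_spectrum mu s)) q 1.
Proof.
have [rho simS] := equiS.
have i0 : 'I_m.
  case: m S p ifsS simS probp {equiS KS ftcS muS} => [|k] S p _ _;
    last by move=> _; exact: ord0.
  by case=> _; rewrite big_ord0 => /eqP; rewrite eq_sym oner_eq0.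
have rho01 : 0 < rho < 1.
  have [rho0 rhoE] := simS i0; rewrite rho0 /=.
  have [rho' rho'1 [_ rho'E]] := ifsS.2 i0.
  suff -> : rho = rho' by [].
  (* The common ratio and the contraction ratio agree, as both scale the same vector, nonzero since
     [d > 0]. *)
  have := rhoE (const_mx 1) 0; rewrite rho'E subr0.
  move=> /esym; apply: mulIf; rewrite enorm_eq0;
    apply/eqP => /rowP/(_ (Ordinal d_gt0))/eqP.
  by rewrite !mxE oner_eq0.
have /andP[rho0 rho1] := rho01.
have [Pr [C [PrC Prd]]] := level_pressure simS rho0 rho1 KS ftcS probp.
have LE s : 0 < s -> Lq_spectrum mu s = (Pr s / ln rho)%:E.
  by move=> s0; apply: (Lq_spectrum_level simS rho01 KS ftcS probp muS s0 (PrC s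
    (ltW s0))).
move=> q q0; split; first by rewrite LE.
apply: (@near_eq_derivable _ _ _ (fun s => Pr s / ln rho)).
  near=> s; rewrite LE//.
  by near: s; exact: lt_nbhsr.
apply: derivableM; first exact: Prd.
exact: derivable_cst.
Unshelve. all: by end_near. Qed.
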